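(* Let $K$ be the algebraic closure of a finite field $\mathbb{F}_q$ of characteristic $p$. Let $\alpha_1,\dots,\alpha_r\in K$ be pairwise distinct, let $m$ be a positive integer with $p\nmid m$, let $\lambda_1,\dots,\lambda_r$ be integers with $1\le\lambda_i<m$, set $\lambda_0:=\sum_{i=1}^r\lambda_i$ and suppose $\gcd(m,\lambda_0)=1$. Let $\mathcal{F}=K(x,y)$ be the function field of the curve $y^m=\prod_{i=1}^r(x-\alpha_i)^{\lambda_i}$, and let $Q_\infty$ be the only place of $\mathcal{F}$ over the pole of $x$ in $K(x)$. Suppose that $\lambda_\ell=1$ for some $1\le\ell\le r$ and let $Q_\ell$ be the unique place of $\mathcal{F}$ lying over the zero of $x-\alpha_\ell$ in $K(x)$. Then $$\Gamma(Q_\infty,Q_\ell)=\left\{(mj_1-i\lambda_0,\,i+mj_2)\in\mathbb{N}^2\ \middle|\ 1\le i\le m-1,\ j_1\ge\left\lceil\frac{i\lambda_0}{m}\right\rceil,\ j_2\ge0,\ j_1+j_2=\sum_{k=1}^r\left\lceil\frac{i\lambda_k}{m}\right\rceil-1\right\},$$ where $i,j_1,j_2$ range over integers.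
   Context: $\mathbb{N}=\{0,1,2,\dots\}$; $\lceil\cdot\rceil$ is the ceiling function; $(z)_\infty$ is the pole divisor of $z$. For a place $P$ of $\mathcal{F}/K$: $H(P)=\{s\in\mathbb{N}\mid (z)_\infty=sP\text{ for some }z\in\mathcal{F}\}$ and $G(P)=\mathbb{N}\setminus H(P)$. For two distinct places: $H(P_1,P_2)=\{(s_1,s_2)\in\mathbb{N}^2\mid (z)_\infty=s_1P_1+s_2P_2\text{ for some }z\in\mathcal{F}\}$. Minimal generating set: for $\beta\in G(P_1)$ let $n_\beta=\min\{\gamma\in\mathbb{N}\mid(\beta,\gamma)\in H(P_1,P_2)\}$. It is known that $\beta\mapsto n_\beta$ is a bijection $G(P_1)\to G(P_2)$. The minimal generating set of $H(P_1,P_2)$ is its graph $\Gamma(P_1,P_2)=\{(\beta,n_\beta)\mid\beta\in G(P_1)\}$. *)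

(* Defs.v *)
From HB Require Import structures.
From mathcomp Require Import all_boot all_order all_algebra all_field.
From mathcomp Require Import boolp classical_sets functions.

Set Implicit Arguments.
Unset Strict Implicit.
Unset Printing Implicit Defensive.

Import Order.TTheory GRing.Theory Num.Theory.
Local Open Scope ring_scope.
Local Open Scope classical_set_scope.

Section Places.
Variables (K F : fieldType) (iota : {rmorphism K -> F}).

(* A valuation ring of F/K: a subring O of F, with K strictly contained in O
   and O strictly contained in F, that contains z or z^-1 for every z in F. *)
Definition is_valuation_ring (O : {pred F}) : Prop :=
  [/\ subring_closed O,
      (forall c : K, iota c \in O),
      (exists2 z, z \in O & forall c : K, z <> iota c),
      (exists z, z \notin O)
    & (forall z, z \in O \/ z^-1 \in O)].

(* A place is the maximal ideal of a valuation ring of F/K.  The ideal and the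
   ring determine each other, so the ring is what is recorded. *)
Record place := Place {
  vring : {pred F};
  vringP : is_valuation_ring vring }.

Definition place_unit (P : place) : {pred F} :=
  [pred z | [&& z != 0, z \in vring P & z^-1 \in vring P]].

Definition place_ideal (P : place) : {pred F} :=
  [pred z | (z \in vring P) && (z \notin place_unit P)].

Definition prime_element (P : place) (t : F) : Prop :=
  forall z, z \in place_ideal P <-> exists2 w, w \in vring P & z = t * w.

(* v_P(z) = n when z = t^n u for a prime element t of P and a unit u of O_P.
   The value at z = 0, which should be +oo, is the junk value 0. *)
Definition valuation (P : place) (z : F) : int :=
  xget 0 [set n | exists t u,
    [/\ prime_element P t, u \in place_unit P & z = t ^ n * u]].

Definition is_pole (P : place) (z : F) : Prop := valuation P z < 0.
Definition is_zero (P : place) (z : F) : Prop := 0 < valuation P z.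

(* Divisors are written as functions from places to their coefficients; only
   pole divisors and combinations of places are used, so finiteness of the
   support is not recorded. *)
Definition divisor := place -> int.

Definition place_multiple (s : nat) (P : place) : divisor :=
  fun Q => if `[< Q = P >] then s%:Z else 0.

(* As v_P(0) = +oo is never negative, the pole divisor of 0 is 0; this agrees
   with the junk value above, and is also the pole divisor of 1, so allowing
   z = 0 in the semigroups below does not change them. *)
Definition pole_divisor (z : F) : divisor :=
  fun P => if valuation P z < 0 then - valuation P z else 0.

Definition weierstrass_semigroup (P : place) : set nat :=
  [set s | exists z, pole_divisor z = place_multiple s P].

Definition gaps (P : place) : set nat := ~` weierstrass_semigroup P.

Definition weierstrass_semigroup2 (P1 P2 : place) : set (nat * nat) :=
  [set s | exists z, pole_divisor z =
             place_multiple s.1 P1 \+ place_multiple s.2 P2].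

Definition nat_min (A : set nat) : nat :=
  xget 0%N [set n | A n /\ forall k, A k -> (n <= k)%N].

Definition gap_partner (P1 P2 : place) (b : nat) : nat :=
  nat_min [set g | weierstrass_semigroup2 P1 P2 (b, g)].

Definition minimal_generating_set (P1 P2 : place) : set (nat * nat) :=
  [set (b, gap_partner P1 P2 b) | b in gaps P1].

End Places.

Section KummerExtension.
Variable K : fieldType.

Definition ratfun_const : {rmorphism K -> {fraction {poly K}}} :=
  @FracField.tofrac {poly K} \o polyC.

Definition ratfun_X : {fraction {poly K}} := @FracField.tofrac {poly K} 'X.

Variable L : fieldExtType {fraction {poly K}}.

Definition ext_const : {rmorphism K -> L} := in_alg L \o ratfun_const.

Definition lies_over (Q : place ext_const) (P : place ratfun_const) : Prop :=
  forall f, f \in place_ideal P -> f%:A \in place_ideal Q.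

End KummerExtension.

Definition ceil_div (a : int) (m : nat) : int :=
  Num.ceil (a%:~R / m%:R : rat).

(* Main.v *)
Require Import Defs.
From HB Require Import structures.
From mathcomp Require Import all_boot all_order all_algebra all_field.
From mathcomp Require Import boolp classical_sets functions.
From mathcomp Require Import zify ring.

Set Implicit Arguments.
Unset Strict Implicit.
Unset Printing Implicit Defensive.

Import Order.TTheory GRing.Theory Num.Theory.
Local Open Scope ring_scope.
Local Open Scope classical_set_scope.

(** Why the description of the minimal generating set holds.

    Put [u = 1/y].  The place [Qinf] is totally ramified over the pole of [x]
    because [m] is prime to [lambda0], and [Ql] is totally ramified over the
    zero of [x - alpha_l] because [lambda_l = 1]: there
    [v(x) = -m, v(u) = lambda0] and [v(x - alpha_l) = m, v(u) = -1]
    ([total_ramification]).  Writing an element of the function field as a sum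
    of terms [a_i u^i] with [i < m] and [a_i] in [K(x)], the values of the terms
    at either place are distinct modulo [m], so the value of the sum is the
    least of the values of its terms.  In particular both places are determined
    by what they do to [x].

    A pole order [b] at [Qinf] is therefore carried by a single term, the one
    with [b = m j1 - i lambda0]; this determines [i] and [j1]
    ([pole_order_residue]).  Let [C_i] be the sum of the numbers
    [ceil (i lambda_k / m)] over [k <> l].  Among the functions with pole order
    [b] at [Qinf] and no pole outside [Qinf] and [Ql], the product of [u^i], the
    factors [(x - alpha_k)^ceil (i lambda_k / m)] with [k <> l], and
    [(x - alpha_l)^(j1 - C_i)] has the least possible pole at [Ql], of order
    [i + m (C_i - j1)] when this is positive.  That this function has the right
    poles is a computation of values ([extremal_pole_divisor]).  That none does
    better ([second_pole_lower_bound]) goes as follows.  Multiplying by a power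
    of [x - alpha_l], one gets an element that is regular wherever [x] is, hence
    integral over [K[x]] ([place_avoiding], by Zorn's lemma).  Its conjugates
    under [u -> zeta u], for the [m]-th roots of unity [zeta], are integral as
    well, and averaging them shows that each term [a_i u^i] is integral
    ([component_integral]).  Then its [m]-th power is a polynomial in [x], so
    that [a_i] is a polynomial vanishing at each [alpha_k] to order at least
    [i lambda_k / m] ([integral_term]).  Comparing the degree of [a_i], which
    gives the pole at [Qinf], with the number of its zeros gives the bound.

    So [b] is a gap exactly when [i + m (C_i - j1)] is positive, and this number
    is then its partner; with [j2 = C_i - j1] these are the stated pairs.

    The pole divisor of an element says something about a place only if the
    valuation there is not the default value, so discreteness of all places is
    needed ([place_discrete]).  Since the extension is finite over [K(x)], for
    each element two terms of an algebraic equation have the same value, which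
    makes a bounded power of the element equal to a power of a parameter of
    [K(x)] up to a unit. *)

Arguments valuation : simpl never.

(** * Valuation rings and discreteness *)

Section PlaceTheory.
Variables (K F : fieldType) (iota : {rmorphism K -> F}).
Implicit Types (P : place iota) (z w t : F).

Fact vring_subring P : subring_closed (vring P).
Proof. by case: P => O []. Qed.

HB.instance Definition _ P :=
  GRing.isSubringClosed.Build F (vring P) (vring_subring P).

Lemma place_eq P Q : vring P =i vring Q -> P = Q.
Proof.
case: P => O hO; case: Q => O' hO' /= e.
have eO : O = O' by apply: funext => z; exact: e.
by case: _ / eO hO' {e} => hO'; congr Place; apply: Prop_irrelevance.
Qed.

Lemma vring_const P c : iota c \in vring P.
Proof. by case: P => O []. Qed.

Lemma vring_total P z : z \in vring P \/ z^-1 \in vring P.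
Proof. by case: P => O []. Qed.

Lemma vring_proper P : exists z, z \notin vring P.
Proof. by case: P => O []. Qed.

Lemma unit_neq0 P z : z \in place_unit P -> z != 0.
Proof. by case/and3P. Qed.

Lemma unit_vring P z : z \in place_unit P -> z \in vring P.
Proof. by case/and3P. Qed.

Lemma unitV P z : (z^-1 \in place_unit P) = (z \in place_unit P).
Proof. by rewrite !inE invr_eq0 invrK; case: (z \in vring P); rewrite ?andbT ?andbF. Qed.

Lemma unitM P z w :
  z \in place_unit P -> w \in place_unit P -> z * w \in place_unit P.
Proof.
case/and3P=> z0 zO zV /and3P[w0 wO wV].
by rewrite inE mulf_neq0 //= rpredM //= invfM rpredM.
Qed.

Lemma unit1 P : 1 \in place_unit P.
Proof. by rewrite inE oner_neq0 invr1 rpred1. Qed.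

Lemma unitXz P z (n : int) : z \in place_unit P -> z ^ n \in place_unit P.
Proof.
move=> zU; have H (k : nat) : z ^+ k \in place_unit P.
  by elim: k => [|k IH]; rewrite ?expr0 ?unit1 // exprS unitM.
by case: n => k; [exact: H | rewrite NegzE -exprnN unitV H].
Qed.

Lemma unit_const P c : c != 0 -> iota c \in place_unit P.
Proof. by move=> c0; rewrite inE fmorph_eq0 c0 -fmorphV !vring_const. Qed.

Lemma idealP P z : reflect (z \in vring P /\ (z = 0 \/ z^-1 \notin vring P))
                           (z \in place_ideal P).
Proof.
rewrite inE /= inE; apply: (iffP andP) => -[zO].
  rewrite zO /= negb_and negbK => H; split=> //.
  by case/orP: H => [/eqP|]; [left|right].
by case=> [->|/negPf zV]; rewrite ?rpred0 ?eqxx //= zV !andbF.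
Qed.

Lemma notin_vring P z : z \notin vring P -> z^-1 \in place_ideal P.
Proof.
move=> zO; apply/idealP; split; last by right; rewrite invrK.
by case: (vring_total P z) => // h; rewrite h in zO.
Qed.

Lemma place_idealM P z w : z \in place_ideal P -> w \in vring P ->
  z * w \in place_ideal P.
Proof.
case/idealP=> zO zV wO; apply/idealP; split; first exact: rpredM.
have [->|w0] := eqVneq w 0; first by left; rewrite mulr0.
case: zV => [->|zV]; first by left; rewrite mul0r.
right; apply: contra zV => h.
by rewrite -[z^-1](mulfK w0) mulrAC -invfM rpredM.
Qed.

(** The ideal is the Jacobson radical.  One of [(1 + z) / z] and its inverse
    lies in the ring; in the first case so would [z^-1], in the second so does
    [1 - z / (1 + z)], the inverse of [1 + z]. *)
Lemma ideal_unit1D P z : z \in place_ideal P -> 1 + z \in place_unit P.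
Proof.
case/idealP=> zO zV.
have OD : 1 + z \in vring P by rewrite rpredD ?rpred1.
have [->|z0] := eqVneq z 0; first by rewrite addr0 unit1.
case: zV => [/eqP|zV]; first by rewrite (negPf z0).
have n0 : 1 + z != 0.
  apply: contra zV; rewrite addrC addr_eq0 => /eqP ->.
  by rewrite invrN invr1 rpredN rpred1.
have [h|] := vring_total P ((1 + z) / z).
  case/negP: zV; have -> : z^-1 = (1 + z) / z - 1 by field.
  by rewrite rpredB ?rpred1.
rewrite invf_div => h.
have wU : 1 - z / (1 + z) = (1 + z)^-1 by field.
by rewrite inE n0 OD /= -wU rpredB ?rpred1.
Qed.

Lemma unitD_ideal P w z :
  w \in place_unit P -> z \in place_ideal P -> w + z \in place_unit P.
Proof.
move=> wU zI; have w0 := unit_neq0 wU.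
have -> : w + z = w * (1 + z * w^-1) by field.
apply: unitM => //; apply/ideal_unit1D/place_idealM => //.
by rewrite unit_vring ?unitV.
Qed.

Lemma unit_not_ideal P z : z \in place_unit P -> z \in place_ideal P -> False.
Proof. by rewrite [_ \in place_ideal P]inE /= => ->; rewrite andbF. Qed.

Lemma place_idealD P z w : z \in place_ideal P -> w \in place_ideal P ->
  z + w \in place_ideal P.
Proof.
move=> zI wI; rewrite inE /= rpredD; [|by case/idealP: zI|by case/idealP: wI].
apply/negP => U; have wNI : - w \in place_ideal P.
  by rewrite -mulrN1; apply: place_idealM => //; rewrite rpredN rpred1.
by have := unitD_ideal U wNI; rewrite addrK => /unit_not_ideal; apply.
Qed.

(** Integral closedness, for the equation [Y^n = z^n]. *)
Lemma vringX P z n : (0 < n)%N -> (z ^+ n \in vring P) = (z \in vring P).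
Proof.
case: n => // n _; apply/idP/idP => [h|]; last exact: rpredX.
have [//|zV] := vring_total P z.
have [->|z0] := eqVneq z 0; first exact: rpred0.
have -> : z = z ^+ n.+1 * z^-1 ^+ n by rewrite exprVn exprS mulfK ?expf_neq0.
by apply: rpredM => //; apply: rpredX.
Qed.

Lemma unitX P z n : (0 < n)%N -> (z ^+ n \in place_unit P) = (z \in place_unit P).
Proof. by move=> n0; rewrite !inE expf_eq0 n0 /= -exprVn !vringX. Qed.

Lemma idealX P z n : (0 < n)%N ->
  (z ^+ n \in place_ideal P) = (z \in place_ideal P).
Proof. by move=> n0; rewrite inE /= vringX // unitX // inE. Qed.

Lemma ideal_Xz P t (n : int) : t != 0 -> t \in place_ideal P -> 0 < n ->
  t ^ n \in place_ideal P.
Proof. by case: n => [[|n]|] // t0 tI _; rewrite -exprnP idealX. Qed.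

Lemma unit_Xz_eq0 P t (n : int) : t != 0 -> t \in place_ideal P ->
  t ^ n \in place_unit P -> n = 0.
Proof.
move=> t0 tI; case: (ltgtP n 0) => // n0 U.
  rewrite -unitV invr_expz in U.
  by case: (unit_not_ideal U); apply: ideal_Xz; rewrite ?oppr_gt0.
by case: (unit_not_ideal U); apply: ideal_Xz.
Qed.

(** [t] generates the ideal and every nonzero element is a power of [t] up to a
    unit; then the valuation is an honest normalised discrete valuation. *)
Definition uniformizer P t : Prop :=
  prime_element P t /\
  forall z, z != 0 -> exists n : int, exists2 u, u \in place_unit P & z = t ^ n * u.

Lemma uniformizer_neq0 P t : uniformizer P t -> t != 0.
Proof.
case=> tP _; apply/eqP => t0; have [z zO] := vring_proper P.
have [w _] := (tP z^-1).1 (notin_vring zO); rewrite t0 mul0r => /eqP.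
by rewrite invr_eq0 => /eqP z0; rewrite z0 rpred0 in zO.
Qed.

Lemma prime_ideal P t : prime_element P t -> t \in place_ideal P.
Proof. by move=> tP; apply/tP; exists 1; rewrite ?rpred1 ?mulr1. Qed.

(** The relation by which the valuation is computed determines the exponent,
    also when the prime element varies. *)
Lemma valuation_uniformizer P t z (n : int) u :
  uniformizer P t -> u \in place_unit P -> z = t ^ n * u -> valuation P z = n.
Proof.
move=> tU uU zE; have t0 := uniformizer_neq0 tU; case: tU => tP _.
apply: xget_unique; first by exists t, u.
move=> n' [t' [u' [tP' uU' zE']]].
have [w wO tE] := (tP t').1 (prime_ideal tP').
have [w' wO' tE'] := (tP' t).1 (prime_ideal tP).
have ww : w * w' = 1.
  by apply: (mulfI t0); rewrite mulr1 mulrA -tE.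
have w0 : w != 0 by apply: contraTneq isT => h; move/eqP: ww; rewrite h mul0r eq_sym oner_eq0.
have wU : w \in place_unit P.
  by rewrite inE w0 wO /= -[w^-1]mulr1 -ww mulKf.
have u0 := unit_neq0 uU'.
have E : t ^ (n' - n) = u * (u' * w ^ n')^-1.
  rewrite expfzDr // -invr_expz; apply/eqP.
  rewrite eqr_div ?mulf_neq0 ?expfz_neq0 //; apply/eqP.
  rewrite mulrCA -expfzMl -tE mulrC.
  by rewrite -zE' zE mulrC.
apply/eqP; rewrite -subr_eq0; apply/eqP; apply: (@unit_Xz_eq0 P t) => //.
  exact: prime_ideal.
by rewrite E unitM // unitV unitM // unitXz.
Qed.

(** If some fixed power of every element is, up to a unit, a power of one
    element [pi] of the ideal, then the valuation ring is discrete: the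
    exponents form a nonzero subgroup of the integers, and an element with the
    least positive exponent is a prime element. *)
Lemma uniformizer_exists P (pi : F) (N : nat) :
    pi != 0 -> pi \in place_ideal P -> (0 < N)%N ->
    (forall z, z != 0 ->
       exists n : int, exists2 u, u \in place_unit P & z ^+ N = pi ^ n * u) ->
  exists t, uniformizer P t.
Proof.
move=> pi0 piI N0 H.
pose S (n : nat) := (0 < n)%N /\ exists z u,
  [/\ z != 0, u \in place_unit P & z ^+ N = pi ^ n%:Z * u].
have exS : exists n, `[< S n >].
  by exists N; apply/asboolP; split=> //; exists pi, 1; rewrite unit1 mulr1.
have [n0 /asboolP [n0_gt [t [u [t0 uU tE]]]] nmin] := ex_minnP exS.
have tI : t \in place_ideal P.
  rewrite -(idealX _ t N0) tE; apply: place_idealM; last exact: unit_vring.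
  exact: ideal_Xz.
have dec z : z != 0 -> exists n : int, exists2 v, v \in place_unit P & z = t ^ n * v.
  move=> z0; have [s [v vU zE]] := H z z0.
  exists (s %/ n0)%Z; exists (z * t ^ (- (s %/ n0)%Z)); last first.
    by rewrite mulrCA -expfzDr // subrr expr0z mulr1.
  set q := (s %/ n0)%Z.
  have E : (z * t ^ (- q)) ^+ N = pi ^ (s %% n0)%Z * (v * u ^ (- q)).
    rewrite exprMn zE exprnP exprzAC -exprnP tE expfzMl exprz_exp.
    rewrite mulrACA -expfzDr //; congr (_ ^ _ * _).
    by rewrite {1}(divz_eq s n0) -/q; ring.
  have vuU : v * u ^ (- q) \in place_unit P by rewrite unitM ?unitXz.
  have r_lt : (s %% n0)%Z < n0%:Z by rewrite ltz_pmod.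
  have r_ge : 0 <= (s %% n0)%Z by rewrite modz_ge0 // eqz_nat -lt0n.
  case rE : (s %% n0)%Z r_ge r_lt E => [[|r]|] // _ r_lt E.
    by rewrite -(unitX _ _ N0) E expr0z mul1r.
  have /nmin : `[< S r.+1 >].
    apply/asboolP; split=> //; exists (z * t ^ (- q)), (v * u ^ (- q)).
    by rewrite mulf_neq0 ?expfz_neq0.
  by rewrite leqNgt -ltz_nat r_lt.
exists t; split=> // z; split=> [zI|[w wO ->]]; last exact: place_idealM.
have [->|z0] := eqVneq z 0; first by exists 0; rewrite ?rpred0 ?mulr0.
have [n [v vU zE]] := dec z z0.
have n_gt : 0 < n.
  case: (ltgtP n 0) => // [n_lt|n_eq]; case: (@unit_not_ideal P z) => //.
    have: z \in vring P by case/idealP: zI.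
    have tnI := @ideal_Xz P t (- n) t0 tI; rewrite oppr_gt0 in tnI.
    move=> zO; have := place_idealM (tnI n_lt) zO.
    rewrite zE mulrA -expfzDr // addNr expr0z mul1r => vI.
    by case: (unit_not_ideal vU vI).
  by rewrite zE n_eq expr0z mul1r.
exists (t ^ (n - 1) * v).
  apply: rpredM; last exact: unit_vring.
  case: n n_gt {zE} => [[|k]|] // _; rewrite -[k.+1]addn1 PoszD addrK.
  by apply: rpredX; case/idealP: tI.
have e : t ^ n = t ^ (n - 1) * t by rewrite -{1}[n](subrK 1) [LHS]expfzDr.
by rewrite zE e mulrAC mulrC.
Qed.

(** A sum of terms whose pairwise quotients are not units behaves like its
    dominant term. *)
Lemma dominant_term P (I : finType) (s : I -> F) :
    (forall i j, i != j -> s i != 0 -> s j != 0 -> s i / s j \notin place_unit P) ->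
    (exists i, s i != 0) ->
  exists i, [/\ s i != 0, forall j, s j / s i \in vring P
              & (\sum_k s k) / s i \in place_unit P].
Proof.
move=> sU [i0 si0].
pose le z w := (w == 0) || (z != 0) && (w / z \in vring P).
have le_refl : reflexive le.
  move=> z; rewrite /le; case: eqVneq => //= z0; by rewrite divff ?rpred1.
have le_trans : transitive le.
  move=> w z t; rewrite /le; case: (eqVneq t 0) => //= t0.
  case: (eqVneq w 0) => //= w0 /andP[z0 h] h'; rewrite z0 /=.
  have -> : t / z = (t / w) * (w / z) by rewrite mulrA divfK.
  exact: rpredM.
have le_total : total le.
  move=> z w; rewrite /le; case: (eqVneq z 0) => [|z0] /=; first by rewrite orbT.
  case: (eqVneq w 0) => //= w0; rewrite -[z / w]invf_div.
  by apply/orP; exact: vring_total.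
have := @extremumP _ _ le i0 predT s le_refl le_trans le_total isT.
case=> i _ imin.
have si : s i != 0.
  by have := imin i0 isT; rewrite /le (negPf si0) /= => /andP[].
have quoO j : s j / s i \in vring P.
  have := imin j isT; rewrite /le si /=.
  by case: eqVneq => [->|] //=; rewrite mul0r rpred0.
exists i; split=> //.
rewrite (bigD1 i) //= mulrDl divff // mulr_suml.
apply: unitD_ideal; first exact: unit1.
apply: (big_ind (fun z => z \in place_ideal P)) => [|z w|j ji].
- by apply/idealP; rewrite rpred0; split=> //; left.
- exact: place_idealD.
- rewrite inE /= quoO /=; case: (eqVneq (s j) 0) => [->|sj]; last exact: sU.
  by rewrite mul0r inE eqxx.
Qed.

(** A nonzero valuation is not the default value, so it comes from a prime
    element. *)
Lemma valuation_exponent P z : valuation P z != 0 ->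
  exists t u, [/\ prime_element P t, t != 0, u \in place_unit P & z = t ^ valuation P z * u].
Proof.
rewrite /valuation; case: xgetP => [n _ [t [u [tP uU zE]]] n0|_]; last by rewrite eqxx.
exists t, u; split=> //; apply: contraTneq isT => t0.
have [w wO] := vring_proper P.
have [v _] := (tP w^-1).1 (notin_vring wO); rewrite t0 mul0r => /eqP.
by rewrite invr_eq0 => /eqP w0; rewrite w0 rpred0 in wO.
Qed.

Lemma valuation_gt0_ideal P z : 0 < valuation P z -> z \in place_ideal P.
Proof.
move=> n0; have [|t [u [tP t0 uU zE]]] := @valuation_exponent P z.
  by rewrite gt_eqF.
rewrite zE; apply: place_idealM (unit_vring uU).
exact: ideal_Xz (prime_ideal tP) n0.
Qed.

Lemma valuation_lt0_ideal P z : valuation P z < 0 -> z^-1 \in place_ideal P.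
Proof.
move=> n0; have [|t [u [tP t0 uU zE]]] := @valuation_exponent P z.
  by rewrite lt_eqF.
rewrite zE invfM invr_expz; apply: place_idealM; last by rewrite unit_vring ?unitV.
by apply: ideal_Xz; rewrite ?oppr_gt0 //; exact: prime_ideal.
Qed.

(** At a pole the inverse is a multiple of a prime element, so the element
    cannot lie in the ring as well. *)
Lemma valuation_vring_ge0 P z : z \in vring P -> 0 <= valuation P z.
Proof.
move=> zO; rewrite leNgt; apply/negP => n0.
have zI := valuation_lt0_ideal n0; have := place_idealM zI zO.
have [z0|z0] := eqVneq z 0.
  have [|t [u [tP t0 uU /eqP]]] := @valuation_exponent P z.
    by rewrite lt_eqF.
  by rewrite {1}z0 eq_sym mulf_eq0 expfz_eq0 (negPf t0) andbF (negPf (unit_neq0 uU)).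
rewrite mulVf // => h; exact: unit_not_ideal (unit1 P) h.
Qed.

Section Discrete.
Variable P : place iota.
Hypothesis dP : exists t, uniformizer P t.
Local Notation v := (valuation P).

Lemma val_unit z : z \in place_unit P -> v z = 0.
Proof.
by case: dP => t tU zU; apply: (valuation_uniformizer tU zU); rewrite expr0z mul1r.
Qed.

Lemma valM z w : z != 0 -> w != 0 -> v (z * w) = v z + v w.
Proof.
case: dP => t tU z0 w0; have t0 := uniformizer_neq0 tU.
have [n [a aU zE]] := tU.2 z z0; have [k [b bU wE]] := tU.2 w w0.
rewrite (valuation_uniformizer tU aU zE) (valuation_uniformizer tU bU wE).
apply: (valuation_uniformizer tU (unitM aU bU)).
by rewrite zE wE expfzDr // mulrACA.
Qed.

Lemma val_uniformizer : exists2 t, t != 0 & v t = 1.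
Proof.
case: dP => t tU; exists t; first exact: uniformizer_neq0 tU.
by apply: (valuation_uniformizer tU (unit1 P)); rewrite expr1z mulr1.
Qed.

Lemma val0 : v 0 = 0.
Proof.
apply/eqP; apply: contraT => /valuation_exponent[t [u [_ t0 uU /eqP]]].
by rewrite eq_sym mulf_eq0 expfz_eq0 (negPf t0) andbF (negPf (unit_neq0 uU)).
Qed.

Lemma valV z : v z^-1 = - v z.
Proof.
have [->|z0] := eqVneq z 0; first by rewrite invr0 val0 oppr0.
have zV0 : z^-1 != 0 by rewrite invr_eq0.
have := valM zV0 z0; rewrite mulVf // (val_unit (unit1 P)).
by move/eqP; rewrite eq_sym addr_eq0 => /eqP.
Qed.

Lemma valX z n : z != 0 -> v (z ^+ n) = n%:Z * v z.
Proof.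
move=> z0; elim: n => [|n IH]; first by rewrite mul0r val_unit ?unit1.
by rewrite exprS valM ?expf_neq0 // IH -addn1 PoszD; ring.
Qed.

Lemma valXz z (n : int) : z != 0 -> v (z ^ n) = n * v z.
Proof.
by move=> z0; case: n => n; rewrite ?NegzE -?invr_expz ?valV valX //; ring.
Qed.

Lemma val_prod (I : Type) (r : seq I) (Q : pred I) (s : I -> F) :
  (forall i, Q i -> s i != 0) ->
  v (\prod_(i <- r | Q i) s i) = \sum_(i <- r | Q i) v (s i).
Proof.
move=> s0; elim: r => [|i r IH]; first by rewrite !big_nil val_unit ?unit1.
rewrite !big_cons; case: ifP => Qi //; rewrite valM ?IH ?s0 //.
apply: (big_ind (fun z => z != 0)) => //; first exact: oner_neq0.
exact: mulf_neq0.
Qed.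

Lemma val_eq0 z : z != 0 -> (v z == 0) = (z \in place_unit P).
Proof.
move=> z0; apply/eqP/idP; last exact: val_unit.
case: dP => t tU; have [n [a aU zE]] := tU.2 z z0.
by rewrite (valuation_uniformizer tU aU zE) zE => ->; rewrite expr0z mul1r.
Qed.

Lemma vring_val z : z != 0 -> (z \in vring P) = (0 <= v z).
Proof.
move=> z0; apply/idP/idP; first exact: valuation_vring_ge0.
rewrite le_eqVlt eq_sym val_eq0 // => /orP[/unit_vring //|/valuation_gt0_ideal].
by case/idealP.
Qed.

Lemma ideal_val z : z != 0 -> (z \in place_ideal P) = (0 < v z).
Proof.
move=> z0; apply/idP/idP; last exact: valuation_gt0_ideal.
by rewrite inE /= -val_eq0 // vring_val // lt0r andbC.
Qed.

Lemma val_dominant (I : finType) (s : I -> F) :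
    (forall i j, s i != 0 -> s j != 0 -> v (s i) = v (s j) -> i = j) ->
    (exists i, s i != 0) ->
  \sum_k s k != 0 /\ exists i, [/\ s i != 0, v (\sum_k s k) = v (s i)
     & forall j, s j != 0 -> v (s i) <= v (s j)].
Proof.
move=> vI ex; have [|i [si mini U]] := @dominant_term P I s _ ex.
  move=> i j ij si sj; have q0 : s i / s j != 0 by rewrite mulf_neq0 ?invr_eq0.
  rewrite -val_eq0 //.
  rewrite valM ?invr_eq0 // valV subr_eq0; apply: contra ij => /eqP h.
  by apply/eqP/vI.
have S0 : \sum_k s k != 0.
  by apply: contraTneq U => ->; rewrite mul0r inE eqxx.
split=> //; exists i; split=> // [|j sj].
  by apply/subr0_eq; rewrite -valV -valM ?invr_eq0 // val_unit.
have := mini j; rewrite vring_val ?mulf_neq0 ?invr_eq0 //.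
by rewrite valM ?invr_eq0 // valV subr_ge0.
Qed.

End Discrete.

End PlaceTheory.

(** * Places of a finite extension of the rational function field *)

Lemma fraction_quotient (R : idomainType) (a : {fraction R}) :
  exists p q : R, q != 0 /\ a = FracField.tofrac p / FracField.tofrac q.
Proof.
elim/quotW: a => r; exists r.1, r.2; split; first exact: denom_ratioP.
have q0 : FracField.tofrac r.2 != 0 by rewrite tofrac_eq0 denom_ratioP.
apply: (mulIf q0); rewrite divfK //.
rewrite !piE; apply/eqmodP; rewrite /= FracField.equivfE /FracField.mulf.
by rewrite !numden_Ratio ?mulf_neq0 ?denom_ratioP ?oner_neq0 // !mulr1 mulrC.
Qed.

(** The extension is given by the embedding of [K[x]] in the field; a bound on
    the degrees of the elements over [K(x)] stands for its finiteness. *)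
Section FunctionField.
Variables (K : closedFieldType) (F : fieldType) (iota : {rmorphism K -> F}).
Variable emb : {rmorphism {poly K} -> F}.
Hypothesis embC : forall c, emb c%:P = iota c.
Hypothesis emb_inj : injective emb.
Implicit Types (P : place iota) (z a : F) (p q : {poly K}).

(** The subfield [K(x)], where [x] is the image of the indeterminate. *)
Definition rational a : Prop := exists p q, q != 0 /\ a = emb p / emb q.

Lemma emb_eq0 p : (emb p == 0) = (p == 0).
Proof. by rewrite -(rmorph0 emb) (inj_eq emb_inj). Qed.

Lemma rational_div a b : rational a -> rational b -> rational (a / b).
Proof.
move=> [p [q [q0 ->]]] [p' [q' [q'0 ->]]]; rewrite invf_div.
have [->|p'0] := eqVneq p' 0.
  exists 0, 1; split; first exact: oner_neq0.
  by rewrite !rmorph0 invr0 !mulr0 mul0r.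
exists (p * q'), (q * p'); split; first exact: mulf_neq0.
by rewrite !rmorphM mulf_div.
Qed.

Lemma emb_linear_neq0 c : emb ('X - c%:P) != 0.
Proof. by rewrite emb_eq0 polyXsubC_eq0. Qed.

Lemma embX_neq0 : emb 'X != 0.
Proof. by rewrite emb_eq0 polyX_eq0. Qed.

Variable D : nat.
Hypothesis algebraic_bound : forall z, exists q : {poly F},
  [/\ q != 0, (size q <= D.+1)%N, root q z & forall i, rational q`_i].

Lemma emb_vring P p : emb 'X \in vring P -> emb p \in vring P.
Proof.
move=> xO; elim/poly_ind: p => [|p c IH]; first by rewrite rmorph0 rpred0.
by rewrite rmorphD rmorphM embC rpredD ?rpredM ?vring_const.
Qed.

Lemma emb_vringX P c :
  emb ('X - c%:P) \in vring P -> emb 'X \in vring P.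
Proof.
by move=> h; rewrite -(subrK c%:P 'X) rmorphD embC rpredD ?vring_const.
Qed.

(** The value of a polynomial in [x] is the sum of those of its linear
    factors, [K] being algebraically closed. *)
Lemma emb_factor p : p != 0 -> exists2 rs : seq K,
   p = lead_coef p *: \prod_(c <- rs) ('X - c%:P) &
   emb p = iota (lead_coef p) * \prod_(c <- rs) emb ('X - c%:P).
Proof.
move=> p0; have [rs pE] := closed_field_poly_normal p; exists rs => //.
have /(congr1 emb) := pE; rewrite -mul_polyC => ->.
by rewrite rmorphM embC rmorph_prod.
Qed.

(** The powers of [z] up to the degree bound satisfy a linear relation over
    [K(x)], two terms of which must have the same value. *)
Lemma power_rational P z : z != 0 -> exists k a u,
  [/\ (0 < k <= D)%N, a != 0, rational a, u \in place_unit P & z ^+ k = a * u].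
Proof.
move=> z0; have [q [q0 szq qz qR]] := algebraic_bound z.
pose s (i : 'I_(size q)) := q`_i * z ^+ i.
have sum0 : \sum_i s i = 0 by rewrite -horner_coef; apply/eqP.
have [i [j [ij si sj U]]] : exists i j : 'I_(size q),
    [/\ (j < i)%N, s i != 0, s j != 0 & s i / s j \in place_unit P].
  apply: contrapT => no.
  have [||i [_ _]] := @dominant_term _ _ _ P _ s; last by rewrite sum0 mul0r inE eqxx.
  - move=> i j ij si sj; apply/negP => U; apply: no.
    case: (ltngtP i j) => h; first 1 last.
    + by exists i, j.
    + by move/val_inj: h ij => ->; rewrite eqxx.
    + by exists j, i; rewrite -invf_div unitV.
  - have l0 : ((size q).-1 < size q)%N by rewrite prednK // size_poly_gt0.
    exists (Ordinal l0); rewrite /s /= mulf_neq0 ?expf_neq0 //.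
    by rewrite -lead_coefE lead_coef_eq0.
move: si sj; rewrite /s !mulf_eq0 !negb_or => /andP[qi zi] /andP[qj zj].
exists (i - j)%N, (q`_j / q`_i), (s i / s j); split=> //.
- by rewrite subn_gt0 ij /= (leq_trans (leq_subr _ _)) // -ltnS (leq_trans (ltn_ord i)).
- by rewrite mulf_neq0 ?invr_eq0.
- exact: rational_div.
have zE : z ^+ i = z ^+ (i - j) * z ^+ j by rewrite -exprD subnK // ltnW.
by rewrite /s zE; field; rewrite qi qj zj.
Qed.

(** The linear polynomials alone decide the values on [K(x)]. *)
Definition local_parameter P (pi : F) : Prop :=
  [/\ pi != 0, pi \in place_ideal P &
   forall c : K, exists n : int, exists2 u, u \in place_unit P & emb ('X - c%:P) = pi ^ n * u].

Lemma local_parameter_poly P pi p : local_parameter P pi -> p != 0 ->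
  exists n : int, exists2 u, u \in place_unit P & emb p = pi ^ n * u.
Proof.
case=> pi0 _ lin p0; have [rs _ ->] := emb_factor p0.
elim: rs => [|c rs [n [u uU E]]].
  exists 0; exists (iota (lead_coef p)); last by rewrite big_nil expr0z mulr1 mul1r.
  by apply: unit_const; rewrite lead_coef_eq0.
have [k [w wU wE]] := lin c; exists (k + n); exists (w * u); first exact: unitM.
rewrite big_cons [LHS]mulrCA E wE [pi ^ (k + n)]expfzDr //.
exact: mulrACA.
Qed.

Lemma local_parameter_base P pi a : local_parameter P pi ->
  rational a -> a != 0 ->
  exists n : int, exists2 u, u \in place_unit P & a = pi ^ n * u.
Proof.
move=> piP [p [q [q0 aE]]] a0.
have p0 : p != 0.
  move: a0; rewrite aE mulf_eq0 emb_eq0 negb_or.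
  by case/andP.
have [n [u uU pE]] := local_parameter_poly piP p0.
have [k [w wU qE]] := local_parameter_poly piP q0.
have pi0 : pi != 0 by case: piP.
exists (n - k); exists (u / w); first by rewrite unitM ?unitV.
by rewrite aE pE qE invfM invr_expz mulrACA -expfzDr.
Qed.

Lemma local_parameter_finite P (c : K) :
  emb ('X - c%:P) \in place_ideal P -> local_parameter P (emb ('X - c%:P)).
Proof.
move=> cI; split=> // [|d]; first by rewrite emb_eq0 polyXsubC_eq0.
have [<-|cd] := eqVneq c d.
  by exists 1; exists 1; rewrite ?unit1 // expr1z mulr1.
exists 0; exists (emb ('X - d%:P)); last by rewrite expr0z mul1r.
have -> : 'X - d%:P = (c - d)%:P + ('X - c%:P) by rewrite polyCB; ring.
rewrite rmorphD embC; apply: unitD_ideal => //.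
by apply: unit_const; rewrite subr_eq0.
Qed.

Lemma pole_linear_unit P (c : K) :
  (emb 'X)^-1 \in place_ideal P -> emb ('X - c%:P) / emb 'X \in place_unit P.
Proof.
move=> cI; have x0 : emb 'X != 0 by exact: embX_neq0.
rewrite rmorphB mulrBl divff // embC -mulNr mulrC; apply: ideal_unit1D.
by apply: (place_idealM cI); rewrite rpredN vring_const.
Qed.

Lemma local_parameter_infinity P :
  (emb 'X)^-1 \in place_ideal P -> local_parameter P (emb 'X)^-1.
Proof.
move=> cI; have x0 : emb 'X != 0 by exact: embX_neq0.
split=> // [|d]; first by rewrite invr_eq0.
exists (-1); exists (emb ('X - d%:P) / emb 'X); first exact: pole_linear_unit.
by rewrite exprN1 invrK mulrC divfK.
Qed.

Lemma local_parameter_exists P : exists pi, local_parameter P pi.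
Proof.
case: (boolP (emb 'X \in vring P)) => [xO|xO]; last first.
  by eexists; apply/local_parameter_infinity/notin_vring.
have [[c cI]|no] := pselect (exists c : K, emb ('X - c%:P) \in place_ideal P).
  by eexists; apply: local_parameter_finite cI.
have polyU p : p != 0 -> emb p \in place_unit P.
  move=> p0; have [rs _ ->] := emb_factor p0.
  apply: unitM; first by apply: unit_const; rewrite lead_coef_eq0.
  apply: (big_ind (fun z => z \in place_unit P)) => [|z w|c _]; first exact: unit1.
  - exact: unitM.
  - apply/negPn/negP => h; apply: no; exists c; rewrite inE /= h andbT.
    by rewrite rmorphB rpredB // embC vring_const.
have baseU a : rational a -> a != 0 -> a \in place_unit P.
  move=> [p [q [q0 ->]]].
  rewrite mulf_eq0 emb_eq0 negb_or => /andP[p0 _]; apply: unitM; first exact: polyU.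
  by rewrite unitV; exact: polyU.
have [z zO] := vring_proper P; case/negP: zO.
have [->|z0] := eqVneq z 0; first exact: rpred0.
have [k [a [u [/andP[k0 _] a0 aR uU zE]]]] := power_rational P z0.
by rewrite -(vringX P z k0) zE unit_vring // unitM // baseU.
Qed.

(** The exponents [k] of [power_rational] all divide [D!], so the [D!]-th power
    of every element is a power of the parameter up to a unit. *)
Lemma place_discrete P : exists t, uniformizer P t.
Proof.
have [pi piP] := local_parameter_exists P; have [pi0 piI _] := piP.
apply: (@uniformizer_exists _ _ _ P pi D`!) => //; first exact: fact_gt0.
move=> z z0; have [k [a [u [/andP[k0 kL] a0 aR uU zE]]]] := power_rational P z0.
have [n [w wU aE]] := local_parameter_base piP aR a0.
have /dvdnP[d ->] : (k %| D`!)%N by rewrite dvdn_fact // k0.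
exists (n * d%:Z); exists ((w * u) ^+ d).
  by rewrite -[_ ^+ d]/(_ ^ d%:Z) unitXz // unitM.
by rewrite mulnC exprM zE aE -mulrA exprMn -exprz_exp.
Qed.

(** ** Values on polynomials at the pole of [x] and at a zero of [x - c] *)

Lemma val_poly_infinity P p : (emb 'X)^-1 \in place_ideal P -> p != 0 ->
  valuation P (emb p) = (size p).-1%:Z * valuation P (emb 'X).
Proof.
move=> xI p0; have dP := place_discrete P; have [rs pE ->] := emb_factor p0.
have szp : size p = (size rs).+1.
  by rewrite pE size_scale ?lead_coef_eq0 // size_prod_XsubC.
have x0 : emb 'X != 0 by exact: embX_neq0.
have l0 : iota (lead_coef p) != 0 by rewrite fmorph_eq0 lead_coef_eq0.
have lin0 c : emb ('X - c%:P) != 0 := emb_linear_neq0 c.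
rewrite szp /= valM //; last first.
  apply: (big_ind (fun z => z != 0)) => //; first exact: oner_neq0.
  exact: mulf_neq0.
rewrite val_unit ?unit_const ?lead_coef_eq0 // add0r val_prod //.
rewrite (eq_bigr (fun=> valuation P (emb 'X))) => [|c _].
  rewrite big_const_seq count_predT; elim: (size rs) => [|n IH]; first by rewrite mul0r.
  by rewrite iterS IH -addn1 PoszD; ring.
have := val_unit dP (pole_linear_unit c xI).
by rewrite valM ?invr_eq0 // valV // => /subr0_eq.
Qed.

Lemma val_poly_zero P (c : K) p : emb ('X - c%:P) \in place_ideal P -> p != 0 ->
  valuation P (emb p) = (mup c p)%:Z * valuation P (emb ('X - c%:P)).
Proof.
move=> cI p0; have dP := place_discrete P.
have [n [q]] := multiplicity_XsubC p c; rewrite p0 /= => qc pE.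
have -> : mup c p = n by rewrite pE mupMr // mup_XsubCX eqxx.
have qU : emb q \in place_unit P.
  have /factor_theorem[q' q'E] : root (q - q.[c]%:P) c.
    by rewrite rootE !hornerE subrr.
  rewrite -(subrK q.[c]%:P q) q'E addrC rmorphD embC rmorphM [emb q' * _]mulrC.
  apply: unitD_ideal; first exact: unit_const.
  apply: place_idealM => //; apply/emb_vring/(@emb_vringX _ c).
  by case/idealP: cI.
rewrite pE rmorphM rmorphXn valM ?expf_neq0 ?(unit_neq0 qU) //; last first.
  by rewrite emb_eq0 polyXsubC_eq0.
by rewrite val_unit // add0r valX // emb_eq0 polyXsubC_eq0.
Qed.

(** ** Places avoiding a non-integral element *)

Section MaximalSubring.
Variables (S : subringClosed F) (w : F).
Hypotheses (wN : w \notin S) (wV : w^-1 \in S).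
Hypothesis S_max : forall t, t \notin S -> exists2 g, g \is a polyOver S & w = g.[t].

Lemma nonmember_neq0 : w != 0.
Proof. by apply: contraNneq wN => ->; exact: rpred0. Qed.

(** [w^-1] lies in the Jacobson radical: adjoining the inverse of an element
    congruent to [1] modulo [w^-1] does not produce [w]. *)
Lemma maximal_jacobson a : w * a \in S -> 1 - a != 0 /\ (1 - a)^-1 \in S.
Proof.
move=> waS; have w0 := nonmember_neq0.
have aS : a \in S by rewrite -(mulKf w0 a) rpredM.
have s0 : 1 - a != 0.
  by rewrite subr_eq0; apply: contraNneq wN => e; rewrite -(mulr1 w) e.
split=> //; apply: contraT => /S_max[g gS wE].
have sS : 1 - a \in S by rewrite rpredB ?rpred1.
have pow n : w - w * (1 - a) ^+ n \in S.
  elim: n => [|n IH]; first by rewrite mulr1 subrr rpred0.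
  have -> : w - w * (1 - a) ^+ n.+1
          = (w - w * (1 - a) ^+ n) + w * a * (1 - a) ^+ n by rewrite exprS; ring.
  by rewrite rpredD // rpredM // rpredX.
case/negP: wN; rewrite -(subrK (w * (1 - a) ^+ size g) w) rpredD //.
rewrite {1}wE horner_coef mulr_suml rpred_sum // => i _.
have -> : (1 - a) ^+ size g = (1 - a) ^+ (size g - i) * (1 - a) ^+ i.
  by rewrite -exprD subnK // ltnW.
rewrite -mulrA rpredM ?(polyOverP gS) //.
by rewrite mulrCA exprVn mulVf ?expf_neq0 // mulr1 rpredX.
Qed.

(** An equation witnessing that [w^-1] generates the unit ideal after
    adjoining [z]. *)
Let relation z n := exists g : {poly F},
  [/\ (size g <= n)%N, w *: g \is a polyOver S & g.[z] = 1].

(** Divided by the unit [1 - h_0], the relation for [z^-1] expresses [z^n]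
    through lower powers of [z], which removes the leading term of the relation
    for [z]. *)
Lemma relation_reduce z n k : z != 0 -> (k <= n.+1)%N ->
  relation z n.+1 -> relation z^-1 k -> relation z n.
Proof.
move=> z0 kn [g [szg gS gz]] [h [szh hS hz]]; have w0 := nonmember_neq0.
have hcoef i : w * h`_i \in S by have := polyOverP hS i; rewrite coefZ.
have gcoef i : w * g`_i \in S by have := polyOverP gS i; rewrite coefZ.
have gnS : g`_n \in S by rewrite -(mulKf w0 g`_n) rpredM.
have [c0 cS] := maximal_jacobson (hcoef 0%N).
pose q := \poly_(j < n) ((1 - h`_0)^-1 * h`_(n - j)).
have qz : q.[z] = z ^+ n.
  rewrite horner_poly (reindex_inj rev_ord_inj) /=.
  apply: (mulfI c0); rewrite mulr_sumr.
  have := hz; rewrite (@horner_coef_wide _ n.+1) ?(leq_trans szh) // big_ord_recl.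
  rewrite expr0 mulr1 => /(canRL (addKr _)); rewrite addrC => sE.
  rewrite -[in RHS]sE mulr_suml; apply: eq_bigr => i _.
  rewrite [lift ord0 i : nat]lift0 subKn // mulrA mulVKf // -mulrA; congr (_ * _).
  have -> : z ^+ n = z ^+ i.+1 * z ^+ (n - i.+1) by rewrite -exprD subnKC.
  by rewrite exprVn mulKf ?expf_neq0.
exists (g - g`_n *: 'X^n + g`_n *: q); split.
- apply/leq_sizeP => j nj; rewrite coefD coefB !coefZ coefXn coef_poly ltnNge nj /=.
  case: eqVneq => [->|ne]; first by rewrite mulr1 subrr mulr0 addr0.
  rewrite !mulr0 subr0 addr0 nth_default //; apply: leq_trans szg _.
  by rewrite ltn_neqAle eq_sym ne.
- apply/polyOverP => i; rewrite coefZ coefD coefB !coefZ coefXn coef_poly.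
  rewrite mulrDr mulrBr rpredD ?rpredB //.
    by rewrite mulrA rpredM // rpred_nat.
  rewrite mulrCA rpredM //; case: ifP => _; last by rewrite mulr0 rpred0.
  by rewrite mulrCA rpredM.
- by rewrite !hornerE qz gz subrK.
Qed.

(** The longer of two such relations can be shortened, down to an empty one. *)
Lemma relations_exclude z n k : z != 0 -> relation z n -> relation z^-1 k -> False.
Proof.
move: {2}(n + k)%N (leqnn (n + k)) => N; elim: N z n k => [|N IH] z n k.
  rewrite leqn0 addn_eq0 => /andP[/eqP -> _] _ [g [+ _ +]] _.
  by rewrite leqn0 size_poly_eq0 => /eqP ->; rewrite horner0 => /esym/eqP; rewrite oner_eq0.
have rel0 t : relation t 0 -> False.
  move=> [g [+ _ +]].
  by rewrite leqn0 size_poly_eq0 => /eqP ->; rewrite horner0 => /esym/eqP; rewrite oner_eq0.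
move=> nk z0 rz rzV.
case: n nk rz => [|n] nk rz; first exact: rel0 rz.
case: k nk rzV => [|k] nk rzV; first exact: rel0 rzV.
case: (leqP k.+1 n.+1) => kn.
  by apply: (IH z n k.+1) => //; apply: relation_reduce rz rzV.
apply: (IH z n.+1 k) => //; first by move: nk; rewrite !addnS.
apply: (@relation_reduce _ k n.+1); rewrite ?invr_eq0 ?invrK //.
exact: ltnW.
Qed.

Lemma maximal_subring_total z : z \in S \/ z^-1 \in S.
Proof.
apply: contrapT => no; have w0 := nonmember_neq0.
have z0 : z != 0 by apply/eqP => z0; apply: no; left; rewrite z0 rpred0.
have rel t : t \notin S -> exists n, relation t n.
  case/S_max=> g gS gt; exists (size g), (w^-1 *: g); split=> //.
  - exact: size_scale_leq.
  - by rewrite scalerA divff // scale1r.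
  - by rewrite hornerZ -gt mulVf.
have [|n rn] := rel z; first by apply/negP => h; apply: no; left.
have [|k rk] := rel z^-1; first by apply/negP => h; apply: no; right.
exact: relations_exclude rn rk.
Qed.

End MaximalSubring.

(** An instance of Chevalley's extension theorem.  When [w] is not integral,
    [K[x]] and [w^-1] generate a ring without [w]; by Zorn's lemma it lies in a
    subring maximal for this property, and that is a valuation ring. *)
Lemma place_avoiding w : ~ integralOver emb w ->
  exists P : place iota, emb 'X \in vring P /\ w \notin vring P.
Proof.
move=> wint.
pose good (A : set F) := [/\ GRing.subring_closed (fun z => `[< A z >]),
   forall p, A (emb p), A w^-1 & ~ A w].
have w0 : w != 0 by apply: contra_notN wint => /eqP ->; exact: integral0.
pose R0 : set F := [set z | exists g : {poly {poly K}}, z = (map_poly emb g).[w^-1]].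
have goodR0 : good R0.
  split.
  - split; first by apply/asboolP; exists 1; rewrite rmorph1 hornerC.
    + move=> a b /asboolP[g ->] /asboolP[h ->]; apply/asboolP; exists (g - h).
      by rewrite rmorphB hornerD hornerN.
    + move=> a b /asboolP[g ->] /asboolP[h ->]; apply/asboolP; exists (g * h).
      by rewrite rmorphM hornerM.
  - by move=> p; exists p%:P; rewrite map_polyC hornerC.
  - by exists 'X; rewrite map_polyX hornerX.
  - move=> [g wE]; apply: wint; set n := size g.
    pose h : {poly {poly K}} := \poly_(j < n) g`_(n.-1 - j).
    exists ('X^n - h).
      rewrite monicE lead_coefDl ?lead_coefXn // size_polyN size_polyXn ltnS.
      exact: size_poly.
    rewrite rootE rmorphB /= map_polyXn !hornerE subr_eq0.
    have n0 : (0 < n)%N.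
      rewrite lt0n size_poly_eq0; apply: contraNneq w0 => g0.
      by rewrite wE g0 rmorph0 horner0.
    have gE : w = \sum_(i < n) emb g`_i * w^-1 ^+ i.
      rewrite [LHS]wE (@horner_coef_wide _ n).
        by apply: eq_bigr => i _; rewrite coef_map.
      by rewrite (size_map_inj_poly emb_inj) ?rmorph0.
    have -> : (map_poly emb h).[w] = \sum_(j < n) emb g`_(n.-1 - j) * w ^+ j.
      rewrite (@horner_coef_wide _ n).
        by apply: eq_bigr => j _; rewrite coef_map coef_poly ltn_ord.
      by rewrite (size_map_inj_poly emb_inj) ?rmorph0 // size_poly.
    rewrite -{1}(prednK n0) exprSr {2}gE mulr_sumr (reindex_inj rev_ord_inj) /=.
    apply/eqP/eq_bigr => j _; have -> : (n - j.+1 = n.-1 - j)%N by lia.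
    have -> : w ^+ n.-1 = w ^+ j * w ^+ (n.-1 - j).
      by rewrite -exprD subnKC //; have := ltn_ord j; lia.
    by rewrite exprVn mulrA mulrAC mulfK ?expf_neq0 // mulrC.
have [X FP Ftot|A [PA Amax]] := @Zorn_bigcup F (fun A => A = set0 \/ good A).
  have [[A XA Agood]|no] := pselect (exists2 A, X A & good A); last first.
    left; apply/seteqP; split=> // z [A XA Az].
    by case: (FP A XA) => [A0|Ag]; [rewrite A0 in Az | case: no; exists A].
  right; have nonempty B z : X B -> B z -> good B.
    by move=> XB Bz; case: (FP B XB) => // B0; rewrite B0 in Bz.
  have common a b : (\bigcup_(B in X) B) a -> (\bigcup_(B in X) B) b ->
      exists B, [/\ X B, good B, B a & B b].
    move=> [B XB Ba] [C XC Cb]; have [BC|CB] := Ftot B C XB XC.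
      by exists C; split=> //; [exact: nonempty Cb | exact: BC].
    by exists B; split=> //; [exact: nonempty Ba | exact: CB].
  split.
  - split; first by apply/asboolP; exists A => //; case: Agood => -[/asboolP].
    + move=> a b /asboolP Ua /asboolP Ub; have [B [XB [[_ subB _] _ _ _] Ba Bb]] := common a b Ua Ub.
      by apply/asboolP; exists B => //; apply/asboolP/subB; apply/asboolP.
    + move=> a b /asboolP Ua /asboolP Ub; have [B [XB [[_ _ mulB] _ _ _] Ba Bb]] := common a b Ua Ub.
      by apply/asboolP; exists B => //; apply/asboolP/mulB; apply/asboolP.
  - by move=> p; exists A => //; case: Agood.
  - by exists A => //; case: Agood.
  - by move=> [B XB Bw]; case: (nonempty B w XB Bw).
have Agood : good A.
  case: PA => // A0; case: (Amax R0); last by right.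
  rewrite A0; split=> // h; have /h // : R0 0.
  by exists 0; rewrite rmorph0 horner0.
have [Aring Aemb AwV Aw] := Agood.
pose Ap : {pred F} := fun z => `[< A z >].
pose S : subringClosed F := HB.pack Ap (GRing.isSubringClosed.Build F Ap Aring).
have AS z : (z \in S) = `[< A z >] by [].
have S_max t : t \notin S -> exists2 g, g \is a polyOver S & w = g.[t].
  move=> tS; pose B : set F := [set z | exists2 g, g \is a polyOver S & z = g.[t]].
  apply: contrapT => noB; case: (Amax B).
    split=> [z Az|BA].
      by exists z%:P; rewrite ?hornerC // polyOverC AS; apply/asboolP.
    case/negP: tS; rewrite AS; apply/asboolP/BA; exists 'X; last by rewrite hornerX.
    exact: polyOverX.
  right; split=> //.
  - split; first by apply/asboolP; exists 1; rewrite ?hornerC // rpred1.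
    + move=> a b /asboolP[g gS ->] /asboolP[h hS ->]; apply/asboolP.
      by exists (g - h); rewrite ?rpredB // hornerD hornerN.
    + move=> a b /asboolP[g gS ->] /asboolP[h hS ->]; apply/asboolP.
      by exists (g * h); rewrite ?rpredM // hornerM.
  - move=> p; exists (emb p)%:P; last by rewrite hornerC.
    by rewrite polyOverC AS; apply/asboolP.
  - exists (w^-1)%:P; last by rewrite hornerC.
    by rewrite polyOverC AS; apply/asboolP.
have wS : w \notin S by rewrite AS; apply/asboolP.
have wVS : w^-1 \in S by rewrite AS; apply/asboolP.
have Sval : @is_valuation_ring K F iota S.
  split=> //.
  - by move=> c; rewrite -embC; apply/asboolP.
  - exists (emb 'X) => [|c]; first by apply/asboolP.
    rewrite -embC => /emb_inj /(congr1 (fun p : {poly K} => size p)).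
    by rewrite size_polyX size_polyC; case: (c == 0).
  - by exists w.
  - exact: maximal_subring_total wS wVS S_max.
by exists (Place Sval); split=> //=; apply/asboolP.
Qed.

(** * Totally ramified places of a Kummer extension *)

Section Kummer.
Variables (m : nat) (u : F) (f : {poly K}).
Hypothesis m_gt0 : (0 < m)%N.
Hypothesis u_pow : u ^+ m * emb f = 1.
Hypothesis span : forall z, exists a : 'I_m -> F,
  (forall i, rational (a i)) /\ z = \sum_i a i * u ^+ i.

Lemma u_neq0 : u != 0.
Proof.
apply: contraTneq isT => u0; have := u_pow.
by rewrite u0 expr0n gtn_eqF // mul0r => /esym/eqP; rewrite oner_eq0.
Qed.

Lemma f_neq0 : f != 0.
Proof.
apply: contraTneq isT => f0; have := u_pow.
by rewrite f0 rmorph0 mulr0 => /esym/eqP; rewrite oner_eq0.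
Qed.

(** The terms of an expansion in powers of [u] never cancel at [P]: the value
    of the sum is the least value of a term. *)
Definition separates P : Prop := forall a : 'I_m -> F,
  (forall i, rational (a i)) -> (exists i, a i != 0) ->
  \sum_i a i * u ^+ i != 0 /\
  exists i, [/\ a i != 0, valuation P (\sum_i a i * u ^+ i) = valuation P (a i * u ^+ i)
    & forall j, a j != 0 -> valuation P (a i * u ^+ i) <= valuation P (a j * u ^+ j)].

(** Modulo [e] the value of [u] has order [m], so terms with distinct powers of
    [u] have distinct values.  Hence every value is one of a term, and so a
    multiple of [e / m]; as [1] is a value, [e = m]. *)
Lemma total_ramification P (e c : int) :
    0 < e ->
    (forall a, rational a -> a != 0 -> exists k, valuation P a = e * k) ->
    m%:Z * valuation P u = c * e -> coprimez m c ->
  [/\ e = m, valuation P u = c & separates P].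
Proof.
move=> e0 aV uV mc; have dP := place_discrete P; have u0 := u_neq0.
have term0 a (i : nat) : a != 0 -> a * u ^+ i != 0.
  by move=> a0; rewrite mulf_neq0 ?expf_neq0.
have termV a (i : nat) : a != 0 ->
    valuation P (a * u ^+ i) = valuation P a + i%:Z * valuation P u.
  by move=> a0; rewrite valM ?valX ?expf_neq0.
have sep : separates P.
  move=> a aR [i0 ai0].
  have sn i : a i * u ^+ i != 0 -> a i != 0 by apply: contraNneq => ->; rewrite mul0r.
  have [||S0 [i [si Si imin]]] := @val_dominant _ _ _ P dP _ (fun i => a i * u ^+ i).
  - move=> i j /sn ai /sn aj; rewrite !termV // => E.
    have [k kE] := aV _ (aR i) ai; have [l lE] := aV _ (aR j) aj.
    have {}E : m%:Z * (k - l) = (j%:Z - i%:Z) * c.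
      have h : valuation P u * i%:Z + e * k = valuation P u * j%:Z + e * l.
        by rewrite ![valuation P u * _]mulrC ![_ + e * _]addrC -kE -lE.
      have ce : e * (m%:Z * (k - l) - (j%:Z - i%:Z) * c) = 0.
        have -> : e * (m%:Z * (k - l) - (j%:Z - i%:Z) * c)
           = m%:Z * (e * k - e * l) - (j%:Z - i%:Z) * (c * e) by ring.
        rewrite -uV; have -> : e * k = valuation P u * j%:Z + e * l - valuation P u * i%:Z.
          by rewrite -h; ring.
        ring.
      by move/eqP: ce; rewrite mulf_eq0 (gt_eqF e0) subr_eq0 => /eqP.
    have : (m%:Z %| (j%:Z - i%:Z))%Z.
      by rewrite -(Gauss_dvdzl _ mc) -E dvdz_mulr.
    case/dvdzP=> q qE; apply: val_inj => /=; have := ltn_ord i; have := ltn_ord j.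
    case: (ltgtP q 0) => q0; nia.
  - by exists i0; apply: term0.
  - split=> //; exists i; split=> //; first exact: sn.
    by move=> j aj; apply/imin/term0.
have /dvdzP[d dE] : (m%:Z %| e)%Z.
  by rewrite -(Gauss_dvdzr _ mc) -uV dvdz_mulr.
have m0 : m%:Z != 0 by rewrite eqz_nat -lt0n.
have uE : valuation P u = c * d.
  by apply: (mulfI m0); rewrite uV dE; ring.
have [t t0 t1] := val_uniformizer dP.
have d_dvd1 : (d %| 1)%Z.
  have [a [aR tE]] := span t.
  have [|_ [i [ai Ei _]]] := sep a aR.
    apply: contrapT => no; case/negP: t0; rewrite tE big1 // => i _.
    have [->|ai] := eqVneq (a i) 0; first by rewrite mul0r.
    by case: no; exists i.
  have [k kE] := aV _ (aR i) ai.
  apply/dvdzP; exists (m%:Z * k + i%:Z * c).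
  transitivity (valuation P t); first by rewrite t1.
  by rewrite tE Ei termV // kE uE dE; ring.
have d1 : d = 1.
  have : 0 < d by have : 0 < m%:Z by []; nia.
  by move: d_dvd1; rewrite dvdz1 => /eqP; lia.
by split=> //; rewrite ?dE ?uE d1 ?mul1r ?mulr1.
Qed.

Lemma rational_val P (w : F) (n : {poly K} -> int) a :
  (forall p, p != 0 -> valuation P (emb p) = n p * valuation P w) ->
  rational a -> a != 0 -> exists k, valuation P a = valuation P w * k.
Proof.
move=> nP [p [q [q0 ->]]] a0; have dP := place_discrete P.
have p0 : p != 0 by apply: contraNneq a0 => ->; rewrite rmorph0 mul0r.
exists (n p - n q); rewrite valM ?invr_eq0 ?emb_eq0 // valV // !nP //; ring.
Qed.

Lemma ramified_infinity P : coprime m (size f).-1 ->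
    (emb 'X)^-1 \in place_ideal P ->
  [/\ valuation P (emb 'X) = - m%:Z, valuation P u = (size f).-1 & separates P].
Proof.
move=> mf xI; have dP := place_discrete P.
have pv p := @val_poly_infinity P p xI.
have xv : 0 < - valuation P (emb 'X).
  by rewrite -valV // -ideal_val // invr_eq0 embX_neq0.
have [|||e1 e2 e3] := @total_ramification P (- valuation P (emb 'X)) (size f).-1 xv.
- move=> a aR a0; have [k ->] := rational_val pv aR a0; exists (- k); ring.
- have := val_unit dP (unit1 P); rewrite -u_pow valM ?expf_neq0 ?u_neq0 ?emb_eq0 ?f_neq0 //.
  rewrite valX ?u_neq0 // pv ?f_neq0 // => /eqP; rewrite addr_eq0 => /eqP ->; ring.
- by rewrite /coprimez.
- by split=> //; rewrite -e1 opprK.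
Qed.

Lemma ramified_simple_zero P (c : K) : mup c f = 1%N ->
    emb ('X - c%:P) \in place_ideal P ->
  [/\ valuation P (emb ('X - c%:P)) = m, valuation P u = -1 & separates P].
Proof.
move=> fc xI; have dP := place_discrete P.
have pv p := @val_poly_zero P c p xI.
have xv : 0 < valuation P (emb ('X - c%:P)).
  by rewrite -ideal_val // emb_linear_neq0.
apply: total_ramification => //.
- by move=> a aR a0; exact: rational_val pv aR a0.
- have := val_unit dP (unit1 P); rewrite -u_pow valM ?expf_neq0 ?u_neq0 ?emb_eq0 ?f_neq0 //.
  rewrite valX ?u_neq0 // pv ?f_neq0 // fc => /eqP; rewrite addr_eq0 => /eqP ->; ring.
- by apply/eqP; congr Posz; exact: gcdn1.
Qed.

(** The value of every element is the least value of its terms, and the terms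
    have the same values at both places. *)
Lemma separating_unique P Q :
    separates P -> separates Q ->
    (forall p, p != 0 -> valuation P (emb p) = valuation Q (emb p)) ->
    valuation P u = valuation Q u ->
  P = Q.
Proof.
move=> sP sQ pE uE; have dP := place_discrete P; have dQ := place_discrete Q.
apply: place_eq => z; have [->|z0] := eqVneq z 0; first by rewrite !rpred0.
rewrite !vring_val //; have [a [aR zE]] := span z.
have [i0 ai0] : exists i, a i != 0.
  apply: contrapT => no; case/negP: z0; rewrite zE big1 // => i _.
  have [->|ai] := eqVneq (a i) 0; first by rewrite mul0r.
  by case: no; exists i.
have [|_ [i [ai Pi imin]]] := sP a aR; first by exists i0.
have [|_ [j [aj Qj jmin]]] := sQ a aR; first by exists i0.
have tE k : a k != 0 -> valuation P (a k * u ^+ k) = valuation Q (a k * u ^+ k).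
  move=> ak; rewrite !valM ?expf_neq0 ?u_neq0 // !valX ?u_neq0 // uE; congr (_ + _).
  have [p [q [q0 kE]]] := aR k; rewrite kE.
  have p0 : p != 0 by apply: contraNneq ak => p0; rewrite kE p0 rmorph0 mul0r.
  by rewrite !valM ?invr_eq0 ?emb_eq0 // !valV // !pE.
congr (0 <= _); apply/eqP; rewrite eq_le; apply/andP; split.
  by rewrite zE Pi Qj -tE // imin.
by rewrite zE Pi Qj tE // jmin.
Qed.

End Kummer.

(** ** Integrality over the polynomials in [x] *)

Lemma rational_subring : GRing.subring_closed (fun a => `[< rational a >]).
Proof.
split.
- by apply/asboolP; exists 1, 1; rewrite oner_neq0 !rmorph1 divr1.
- move=> a b /asboolP[p [q [q0 ->]]] /asboolP[p' [q' [q'0 ->]]]; apply/asboolP.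
  exists (p * q' - p' * q), (q * q'); rewrite mulf_neq0 //; split=> //.
  by rewrite -mulNr addf_div ?emb_eq0 // rmorphB !rmorphM mulNr.
- move=> a b /asboolP[p [q [q0 ->]]] /asboolP[p' [q' [q'0 ->]]]; apply/asboolP.
  exists (p * p'), (q * q'); rewrite mulf_neq0 //; split=> //.
  by rewrite !rmorphM mulf_div.
Qed.

(** [K[x]] is integrally closed: after clearing denominators, a root of the
    denominator of an integral fraction is a root of the numerator. *)
Lemma integral_rational a : rational a -> integralOver emb a ->
  exists p, a = emb p.
Proof.
case=> p [q [q0 ->]] [g gmonic groot].
move: {2}(size q) (leqnn (size q)) => n.
elim: n p q q0 groot => [|n IH] p q q0 groot szq.
  by move: szq q0; rewrite leqn0 size_poly_eq0 => /eqP ->; rewrite eqxx.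
have [/size_poly1P[c c0 ->]|/closed_rootP[c qc]] := boolP (size q == 1%N).
  exists (c^-1%:P * p); rewrite rmorphM !embC fmorphV mulrC //.
have eq0 : emb q != 0 by rewrite emb_eq0.
have pc : root p c.
  have : \sum_(i < size g) g`_i * p ^+ i * q ^+ ((size g).-1 - i) = 0.
    apply: emb_inj; rewrite rmorph0 rmorph_sum.
    have sum0 : \sum_(i < size g) emb g`_i * (emb p / emb q) ^+ i = 0.
      transitivity (map_poly emb g).[emb p / emb q]; last exact/rootP.
      rewrite [RHS](@horner_coef_wide _ (size g)).
        by apply: eq_bigr => i _; rewrite coef_map.
      by rewrite (size_map_inj_poly emb_inj) ?rmorph0.
    transitivity ((\sum_(i < size g) emb g`_i * (emb p / emb q) ^+ i)
                   * emb q ^+ (size g).-1); last by rewrite sum0 mul0r.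
    rewrite mulr_suml; apply: eq_bigr => i _.
    rewrite !rmorphM !rmorphXn expr_div_n -!mulrA; congr (_ * (_ * _)).
    rewrite -{2}(subnKC (_ : i <= (size g).-1)%N); last by have := ltn_ord i; lia.
    by rewrite exprD mulKf ?expf_neq0.
  have [k szg] : exists k, size g = k.+1.
    by exists (size g).-1; rewrite prednK // size_poly_gt0 monic_neq0.
  have g1 : g`_k = 1 by have /monicP := gmonic; rewrite lead_coefE szg.
  rewrite szg big_ord_recr /= subnn mulr1 g1 mul1r => /(congr1 (horner^~ c)).
  rewrite hornerD horner_sum big1 ?add0r => [|i _].
    by rewrite horner_exp horner0 => /eqP; rewrite expf_eq0 => /andP[].
  by rewrite hornerM horner_exp (rootP qc) expr0n subn_eq0 leqNgt ltn_ord mulr0.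
have /factor_theorem[q' qE] := qc; have /factor_theorem[p' pE] := pc.
have q'0 : q' != 0 by apply: contraNneq q0 => q'0; rewrite qE q'0 mul0r.
have redE : emb p / emb q = emb p' / emb q'.
  by rewrite qE pE !rmorphM -mulf_div divff ?mulr1 // emb_linear_neq0.
rewrite redE in groot *; apply: IH groot _ => //.
by move: szq; rewrite qE size_Mmonic ?monicXsubC // size_XsubC addn2.
Qed.

Section Components.
Variables (m : nat) (u : F) (f : {poly K}).
Hypothesis m_gt0 : (0 < m)%N.
Hypothesis m_neq0 : m%:R != 0 :> K.
Hypothesis u_pow : u ^+ m * emb f = 1.
Hypothesis indep : forall a : 'I_m -> F,
  (forall i, rational (a i)) -> \sum_i a i * u ^+ i = 0 -> forall i, a i = 0.

Lemma u_pow_rational : rational (u ^+ m).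
Proof.
exists 1, f; split; first exact: f_neq0 u_pow.
have ef0 : emb f != 0 by rewrite emb_eq0 (f_neq0 u_pow).
by apply: (mulIf ef0); rewrite u_pow rmorph1 mul1r mulVf.
Qed.

(** Reduction of a polynomial modulo [Y^m - u^m], which does not see a change
    of the root [u] to [c u]. *)
Lemma fold_powers (S : subringClosed F) (B : {poly F}) :
    u ^+ m \in S -> B \is a polyOver S ->
  exists r : 'I_m -> F, (forall i, r i \in S) /\
    forall c, c ^+ m = 1 -> B.[c * u] = \sum_i r i * (c * u) ^+ i.
Proof.
move=> uS BS; pose res (j : 'I_(size B)) := Ordinal (ltn_pmod j m_gt0).
exists (fun i => \sum_(j | res j == i) B`_j * (u ^+ m) ^+ (j %/ m)); split=> [i|c cm].
  by apply: rpred_sum => j _; apply: rpredM; [exact: (polyOverP BS) | exact: rpredX].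
rewrite horner_coef (partition_big res xpredT) //=; apply: eq_bigr => i _.
rewrite mulr_suml; apply: eq_bigr => j /eqP <- /=.
rewrite -mulrA; congr (_ * _); rewrite {1}(divn_eq j m) exprD mulnC exprM.
by rewrite [(c * u) ^+ m]exprMn cm mul1r.
Qed.

(** The conjugates of an integral element are integral: the equation over
    [K[x]] vanishes modulo [Y^m - u^m], hence at every conjugate of [u]. *)
Lemma conjugate_integral (a : 'I_m -> F) (c : F) :
    (forall i, rational (a i)) -> c ^+ m = 1 ->
    integralOver emb (\sum_i a i * u ^+ i) ->
  integralOver emb (\sum_i a i * (c * u) ^+ i).
Proof.
move=> aR cm [g gmonic groot]; exists g => //.
pose S : subringClosed F := HB.pack (fun a => `[< rational a >] : bool)
  (GRing.isSubringClosed.Build F _ rational_subring).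
have inS z : (z \in S) = `[< rational z >] by [].
pose A := \sum_i a i *: 'X^i.
have AE t : A.[t] = \sum_i a i * t ^+ i.
  by rewrite horner_sum; apply: eq_bigr => i _; rewrite hornerZ hornerXn.
pose B := map_poly emb g \Po A.
have BS : B \is a polyOver S.
  apply: polyOver_comp.
    apply/polyOverP => i; rewrite coef_map inS; apply/asboolP.
    by exists g`_i, 1; rewrite oner_neq0 rmorph1 divr1.
  apply: rpred_sum => i _; apply: polyOverZ; last exact: polyOverXn.
  by rewrite inS; apply/asboolP.
have [|r [rS rE]] := @fold_powers S B _ BS.
  by rewrite inS; apply/asboolP; exact: u_pow_rational.
have r0 : forall i, r i = 0.
  apply: indep => [i|]; first by apply/asboolP; rewrite -inS.
  have := rE 1 (expr1n _ _); rewrite mul1r => <-.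
  by rewrite horner_comp AE; apply/rootP.
rewrite rootE -AE -horner_comp -/B rE // big1 // => i _.
by rewrite r0 mul0r.
Qed.

Lemma primitive_root_exists : exists z : K, m.-primitive_root z.
Proof.
pose p : {poly K} := 'X^m - 1.
have p0 : p != 0 by rewrite -size_poly_eq0 size_XnsubC.
have [rs pE] := closed_field_poly_normal p.
have lp : lead_coef p = 1 by apply/monicP; exact: monicXnsubC.
rewrite lp scale1r in pE.
have szrs : size rs = m.
  by apply: succn_inj; rewrite -(size_prod_XsubC rs id) -pE size_XnsubC.
have : has m.-primitive_root rs.
  apply: cyclic.has_prim_root; rewrite ?szrs //.
    apply/allP => z zrs; rewrite unity_rootE -subr_eq0.
    have : root p z by rewrite pE root_prod_XsubC.
    by rewrite rootE !hornerE.
  by rewrite -separable_prod_XsubC -pE; exact: separable_Xn_sub_1.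
by case/hasP => z _ zP; exists z.
Qed.

(** Averaging over the conjugates against a character isolates a term. *)
Lemma component_integral (a : 'I_m -> F) :
    (forall i, rational (a i)) -> integralOver emb (\sum_i a i * u ^+ i) ->
  forall i, integralOver emb (a i * u ^+ i).
Proof.
move=> aR wint i; have [z0 z0P] := primitive_root_exists.
pose z := iota z0; have zP : m.-primitive_root z by rewrite fmorph_primitive_root.
have zm : z ^+ m = 1 := prim_expr_order zP.
have z_neq0 : z != 0.
  by apply: contraTneq isT => h; move: zm; rewrite h expr0n gtn_eqF // => /esym/eqP; rewrite oner_eq0.
have intC (c : K) : integralOver emb (iota c) by rewrite -embC; exact: integral_id.
have sumE : \sum_(s < m) (z ^- i) ^+ s * (\sum_j a j * (z ^+ s * u) ^+ j)
    = iota m%:R * (a i * u ^+ i).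
  transitivity (\sum_(s < m) \sum_(j < m) (z ^+ j / z ^+ i) ^+ s * (a j * u ^+ j)).
    apply: eq_bigr => s _; rewrite mulr_sumr; apply: eq_bigr => j _.
    by rewrite !exprMn -!exprM [(j * s)%N]mulnC; ring.
  rewrite exchange_big (bigD1 i) //= [X in _ + X]big1 ?addr0 => [|j ji].
    rewrite (eq_bigr (fun=> a i * u ^+ i)) => [|s _].
      by rewrite sumr_const card_ord rmorph_nat mulr_natl.
    by rewrite divff ?expf_neq0 // expr1n mul1r.
  rewrite -mulr_suml; set t := z ^+ j / z ^+ i.
  have t1 : t - 1 != 0.
    rewrite subr_eq0; apply: contra ji => /eqP t1.
    have : z ^+ j == z ^+ i by rewrite -(divfK (expf_neq0 i z_neq0) (z ^+ j)) -/t t1 mul1r.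
    by rewrite (eq_prim_root_expr zP) !modn_small.
  have tm : t ^+ m = 1 by rewrite expr_div_n -!exprM ![(_ * m)%N]mulnC !exprM zm !expr1n divr1.
  have := subrX1 t m; rewrite tm subrr => /esym/eqP.
  by rewrite mulf_eq0 (negPf t1) => /eqP ->; rewrite mul0r.
have -> : a i * u ^+ i = iota (m%:R^-1) * (iota m%:R * (a i * u ^+ i)).
  by rewrite fmorphV mulKf // fmorph_eq0.
apply: integral_mul => //; rewrite -sumE.
apply: (big_ind (integralOver emb)); first exact: integral0.
  by move=> v w; exact: integral_add.
move=> s _; apply: integral_mul.
  by rewrite /z -!rmorphXn -fmorphV -rmorphXn.
by apply: conjugate_integral => //; rewrite exprAC zm expr1n.
Qed.

(** The integral elements of one term [K(x) u^i]: by unique factorisation the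
    coefficient is a polynomial divisible enough to cancel the poles of
    [u^i]. *)
Lemma integral_term a (i : nat) : rational a -> integralOver emb (a * u ^+ i) ->
  exists p, a = emb p /\
    forall c, p != 0 -> (i * mup c f <= m * mup c p)%N.
Proof.
move=> aR tint; have f0 : f != 0 := f_neq0 u_pow.
pose S : subringClosed F := HB.pack (fun a => `[< rational a >] : bool)
  (GRing.isSubringClosed.Build F _ rational_subring).
have inS z : (z \in S) = `[< rational z >] by [].
have intX n z : integralOver emb z -> integralOver emb (z ^+ n).
  move=> zint; elim: n => [|n IH]; first exact: integral1.
  by rewrite exprS; exact: integral_mul.
have [|g gE] := @integral_rational ((a * u ^+ i) ^+ m) _ (intX m _ tint).
  apply/asboolP; rewrite -inS exprMn -exprM mulnC exprM.
  by apply: rpredM; apply: rpredX; rewrite inS; apply/asboolP => //; exact: u_pow_rational.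
have amE : a ^+ m = emb (g * f ^+ i).
  rewrite rmorphM rmorphXn -gE exprMn -[u ^+ i ^+ m]exprM mulnC exprM -mulrA.
  by rewrite -exprMn u_pow expr1n mulr1.
have [|p pE] := @integral_rational a aR.
  exists ('X^m - (g * f ^+ i)%:P); first exact: monicXnsubC.
  by rewrite rootE rmorphB /= map_polyXn map_polyC !hornerE amE subrr.
exists p; split=> // c p0.
have pm : p ^+ m = g * f ^+ i by apply: emb_inj; rewrite rmorphXn -pE.
have g0 : g != 0.
  by apply: contraNneq p0 => g0; move/eqP: pm; rewrite g0 mul0r expf_eq0 => /andP[].
have mupX (q : {poly K}) n : q != 0 -> mup c (q ^+ n) = (n * mup c q)%N.
  move=> q0; elim: n => [|n IH]; first by rewrite mupNroot // rootE hornerE oner_eq0.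
  by rewrite exprS mupM ?expf_neq0 // IH mulSn.
by rewrite -!mupX // pm mupM ?expf_neq0 // leq_addl.
Qed.

End Components.

(** * The semigroup of the two places *)

Lemma ceil_div_le (a n : int) m : (0 < m)%N -> (ceil_div a m <= n) = (a <= m%:Z * n).
Proof.
move=> m0; rewrite /ceil_div ceil_le_int ler_pdivrMr ?ltr0n //.
by rewrite -[m%:R]/(m%:~R) -intrM ler_int mulrC.
Qed.

Lemma ceil_div_ge (a : int) m : (0 < m)%N -> a <= m%:Z * ceil_div a m.
Proof. by move=> m0; rewrite -ceil_div_le. Qed.

Lemma mup_prod (I : eqType) (s : seq I) (Q : pred I) (g : I -> {poly K}) c :
  (forall k, g k != 0) ->
  mup c (\prod_(k <- s | Q k) g k) = (\sum_(k <- s | Q k) mup c (g k))%N.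
Proof.
move=> g0; elim: s => [|k s IH].
  by rewrite !big_nil mupNroot // rootE hornerE oner_eq0.
rewrite !big_cons; case: ifP => // _; rewrite mupM ?IH //.
apply: (big_ind (fun p : {poly K} => p != 0)) => //; first exact: oner_neq0.
exact: mulf_neq0.
Qed.

Lemma size_prod_linear (r : nat) (alpha : 'I_r -> K) (n : 'I_r -> nat) :
  size (\prod_k ('X - (alpha k)%:P) ^+ n k) = (\sum_k n k).+1.
Proof.
apply: (proj2 (A := \prod_k ('X - (alpha k)%:P) ^+ n k \is monic)).
apply: (big_ind2 (fun (q : {poly K}) d => q \is monic /\ size q = d.+1)).
- by rewrite monic1 size_poly1.
- move=> q d q' d' [qm qd] [q'm q'd]; rewrite monicMl // q'm; split=> //.
  by rewrite size_Mmonic ?monic_neq0 // qd q'd addnS.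
- by move=> k _; rewrite monic_exp ?monicXsubC ?size_exp_XsubC.
Qed.

Lemma sum_mup_le (r : nat) (alpha : 'I_r -> K) p : injective alpha -> p != 0 ->
  (\sum_k mup (alpha k) p <= (size p).-1)%N.
Proof.
move=> ainj p0.
have : \prod_k ('X - (alpha k)%:P) ^+ mup (alpha k) p %| p.
  have : uniq (index_enum 'I_r) by exact: index_enum_uniq.
  elim: (index_enum _) => [|k s IH] /=; first by rewrite big_nil dvd1p.
  case/andP=> ks /IH hs; rewrite big_cons Gauss_dvdp; first by rewrite -mup_geq ?leqnn.
  rewrite big_seq; apply: (big_ind (fun q => coprimep _ q)) => [|q q'|j js].
  - exact: coprimep1.
  - by rewrite coprimepMr => -> ->.
  - apply/coprimep_expl/coprimep_expr; rewrite coprimep_XsubC root_XsubC.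
    by apply: contra ks => /eqP /ainj <-.
move/(dvdp_leq p0); rewrite size_prod_linear => h.
by rewrite -ltnS prednK // size_poly_gt0.
Qed.

Section Curve.
Variables (r : nat) (alpha : 'I_r -> K) (m : nat) (lambda : 'I_r -> nat) (l : 'I_r).
Hypothesis alpha_inj : injective alpha.
Hypothesis m_gt0 : (0 < m)%N.
Hypothesis m_neq0 : m%:R != 0 :> K.
Hypothesis lambda_l : lambda l = 1%N.
Variable lambda0 : nat.
Hypothesis lambda0E : lambda0 = (\sum_k lambda k)%N.
Hypothesis m_coprime : coprime m lambda0.
Variable f : {poly K}.
Hypothesis fE : f = \prod_k ('X - (alpha k)%:P) ^+ lambda k.
Variable u : F.
Hypothesis u_pow : u ^+ m * emb f = 1.
Hypothesis span : forall z, exists a : 'I_m -> F,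
  (forall i, rational (a i)) /\ z = \sum_i a i * u ^+ i.
Variables Qinf Ql : place iota.
Hypothesis Qinf_pole : (emb 'X)^-1 \in place_ideal Qinf.
Hypothesis Ql_zero : emb ('X - (alpha l)%:P) \in place_ideal Ql.

Let lin k := emb ('X - (alpha k)%:P).
Let lin_neq0 k : lin k != 0. Proof. exact: emb_linear_neq0. Qed.
Let u0 : u != 0. Proof. exact: (u_neq0 m_gt0 u_pow). Qed.

Lemma size_curve : size f = lambda0.+1.
Proof.
by rewrite fE lambda0E size_prod_linear.
Qed.

Lemma mup_curve k : mup (alpha k) f = lambda k.
Proof.
rewrite fE mup_prod => [|j]; last by rewrite expf_neq0 // polyXsubC_eq0.
rewrite (bigD1 k) //= mup_XsubCX eqxx big1 ?addn0 // => j jk.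
by rewrite mup_XsubCX (inj_eq alpha_inj) (negPf jk).
Qed.

Lemma pole_values P : (emb 'X)^-1 \in place_ideal P ->
  [/\ valuation P (emb 'X) = - m%:Z, valuation P u = lambda0 & separates m u P].
Proof.
move=> h; have := ramified_infinity m_gt0 u_pow span _ h.
by rewrite size_curve /=; apply.
Qed.

Lemma zero_values P : lin l \in place_ideal P ->
  [/\ valuation P (lin l) = m, valuation P u = -1 & separates m u P].
Proof.
move=> h; apply: (ramified_simple_zero m_gt0 u_pow span _ h).
by rewrite mup_curve.
Qed.

Lemma pole_unique P : (emb 'X)^-1 \in place_ideal P -> P = Qinf.
Proof.
move=> h; have [x1 u1 s1] := pole_values h.
have [x2 u2 s2] := pole_values Qinf_pole.
apply: (separating_unique m_gt0 u_pow span s1 s2) => [p p0|]; last by rewrite u1 u2.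
by rewrite (val_poly_infinity h p0) (val_poly_infinity Qinf_pole p0) x1 x2.
Qed.

Lemma zero_unique P : lin l \in place_ideal P -> P = Ql.
Proof.
move=> h; have [x1 u1 s1] := zero_values h.
have [x2 u2 s2] := zero_values Ql_zero.
apply: (separating_unique m_gt0 u_pow span s1 s2) => [p p0|]; last by rewrite u1 u2.
by rewrite (val_poly_zero h p0) (val_poly_zero Ql_zero p0) x1 x2.
Qed.

Lemma other_places P : P <> Qinf -> P <> Ql ->
  (forall k, lin k \in vring P) /\ lin l \in place_unit P.
Proof.
move=> Pinf Pl; have xO : emb 'X \in vring P.
  by apply/negPn/negP => h; apply: Pinf; apply: pole_unique; apply: notin_vring.
have linO k : lin k \in vring P by exact: emb_vring.
split=> //; apply/negPn/negP => h; apply: Pl; apply: zero_unique.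
by rewrite inE /= linO.
Qed.

Lemma Qinf_neq_Ql : Qinf <> Ql.
Proof.
move=> e; have : emb 'X \in vring Qinf.
  by rewrite e; apply: (@emb_vringX _ (alpha l)); case/idealP: Ql_zero.
by case/idealP: Qinf_pole => _ [/eqP|]; rewrite ?invr_eq0 ?(negPf embX_neq0) ?invrK // => /negP.
Qed.

(** ** The extremal functions *)

Section Extremal.
Variables (i : nat) (j2 : int).

Definition partial_ceil : int := \sum_(k | k != l) ceil_div (i%:Z * (lambda k)%:Z) m.

Definition extremal : F :=
  u ^+ i * (\prod_(k | k != l) lin k ^ ceil_div (i%:Z * (lambda k)%:Z) m) * lin l ^ (- j2).

(** At every place the value of the extremal function is [1/m] times that of
    its [m]-th power, a product of linear polynomials in [x]. *)
Lemma val_extremal P : m%:Z * valuation P extremal =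
  \sum_(k | k != l) (m%:Z * ceil_div (i%:Z * (lambda k)%:Z) m - i%:Z * (lambda k)%:Z)
      * valuation P (lin k)
  - (m%:Z * j2 + i%:Z) * valuation P (lin l).
Proof.
have dP := place_discrete P.
have linXz k (n : int) : lin k ^ n != 0 by rewrite expfz_neq0.
have prod0 : \prod_(k | k != l) lin k ^ ceil_div (i%:Z * (lambda k)%:Z) m != 0.
  by apply: (big_ind (fun z => z != 0)) => //; [exact: oner_neq0 | exact: mulf_neq0].
have uV : m%:Z * valuation P u = - \sum_k (lambda k)%:Z * valuation P (lin k).
  have := val_unit dP (unit1 P); rewrite -u_pow valM ?expf_neq0 ?emb_eq0 ?(f_neq0 u_pow) //.
  rewrite valX // fE rmorph_prod val_prod // => [|k _]; last first.
    by rewrite rmorphXn expf_neq0 ?lin_neq0.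
  move/eqP; rewrite addr_eq0 => /eqP ->; congr (- _); apply: eq_bigr => k _.
  by rewrite rmorphXn valX ?lin_neq0.
rewrite /extremal !valM ?mulf_neq0 ?expf_neq0 // valX // valXz // val_prod //.
rewrite !mulrDr mulrCA uV (bigD1 l) //= lambda_l.
have -> : \sum_(k | k != l) valuation P (lin k ^ ceil_div (i%:Z * (lambda k)%:Z) m)
    = \sum_(k | k != l) ceil_div (i%:Z * (lambda k)%:Z) m * valuation P (lin k).
  by apply: eq_bigr => k _; rewrite valXz.
have -> : \sum_(k | k != l)
    (m%:Z * ceil_div (i%:Z * (lambda k)%:Z) m - i%:Z * (lambda k)%:Z) * valuation P (lin k)
  = m%:Z * (\sum_(k | k != l) ceil_div (i%:Z * (lambda k)%:Z) m * valuation P (lin k))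
    - i%:Z * \sum_(k | k != l) (lambda k)%:Z * valuation P (lin k).
  by rewrite !mulr_sumr -sumrB; apply: eq_bigr => k _; ring.
ring.
Qed.

Lemma val_extremal_other P : P <> Qinf -> P <> Ql -> 0 <= valuation P extremal.
Proof.
move=> Pinf Pl; have [linO linU] := other_places Pinf Pl.
have m0 : 0 < m%:Z by [].
rewrite -(pmulr_rge0 _ m0) val_extremal (val_unit (place_discrete P) linU) mulr0 subr0.
apply: sumr_ge0 => k _; rewrite mulr_ge0 ?valuation_vring_ge0 //.
by rewrite subr_ge0 ceil_div_ge.
Qed.

Lemma val_extremal_Qinf :
  valuation Qinf extremal = - (m%:Z * (partial_ceil - j2) - i%:Z * lambda0%:Z).
Proof.
have m0 : m%:Z != 0 by rewrite eqz_nat -lt0n.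
have [xV _ _] := pole_values Qinf_pole.
have linV k : valuation Qinf (lin k) = - m%:Z.
  by rewrite val_poly_infinity ?polyXsubC_eq0 // size_XsubC xV mul1r.
apply: (mulfI m0); rewrite val_extremal; under eq_bigr do rewrite linV.
rewrite linV -mulr_suml sumrB -mulr_sumr -mulr_sumr -/partial_ceil.
have -> : lambda0%:Z = 1 + \sum_(k | k != l) (lambda k)%:Z.
  by rewrite lambda0E (bigD1 l) //= lambda_l PoszD (big_morph Posz PoszD (erefl _)).
ring.
Qed.

Lemma val_extremal_Ql : valuation Ql extremal = - (i%:Z + m%:Z * j2).
Proof.
have m0 : m%:Z != 0 by rewrite eqz_nat -lt0n.
have [xV _ _] := zero_values Ql_zero.
have linV k : k != l -> valuation Ql (lin k) = 0.
  move=> kl; rewrite (val_poly_zero Ql_zero) ?polyXsubC_eq0 //.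
  by rewrite mupNroot ?mul0r // root_XsubC (inj_eq alpha_inj) eq_sym.
apply: (mulfI m0); rewrite val_extremal big1 => [|k kl]; last by rewrite linV // mulr0.
by rewrite xV; ring.
Qed.

Lemma extremal_pole_divisor (b g : nat) :
    b%:Z = m%:Z * (partial_ceil - j2) - i%:Z * lambda0%:Z ->
    g%:Z = Num.max 0 (i%:Z + m%:Z * j2) ->
  weierstrass_semigroup2 Qinf Ql (b, g).
Proof.
move=> bE gE; exists extremal; apply: funext => P /=.
rewrite /pole_divisor /place_multiple /=.
have [->|Pinf] := pselect (P = Qinf).
  rewrite (asbool_equiv_eq (Q := True)) //.
  rewrite asboolT // asboolF; last exact: Qinf_neq_Ql.
  rewrite addr0 val_extremal_Qinf -bE; case: ltP => h; [by rewrite opprK | lia].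
rewrite (asboolF Pinf) add0r.
have [->|Pl] := pselect (P = Ql).
  by rewrite asboolT // val_extremal_Ql gE; case: ltP => h; lia.
by rewrite (asboolF Pl) ltNge val_extremal_other.
Qed.

End Extremal.

(** ** The lower bound *)

(** The term responsible for the pole at [Qinf] has a polynomial coefficient
    whose degree is fixed by [b]; its zeros at the [alpha_k] with [k <> l] use up
    at least [partial_ceil i] of it, which limits the zero at [alpha_l]. *)
Lemma second_pole_lower_bound (b g i : nat) (j1 : int) :
    (0 < b)%N -> (i < m)%N -> b%:Z = m%:Z * j1 - i%:Z * lambda0%:Z ->
    weierstrass_semigroup2 Qinf Ql (b, g) ->
  i%:Z + m%:Z * (partial_ceil i - j1) <= g%:Z.
Proof.
move=> b0 im bE [z zdiv].
have dinf := place_discrete Qinf; have dl := place_discrete Ql.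
have mz0 : 0 < m%:Z by [].
have divE P : (if valuation P z < 0 then - valuation P z else 0)
   = place_multiple b Qinf P + place_multiple g Ql P by rewrite -[LHS]/(pole_divisor z P) zdiv.
have zinf : valuation Qinf z = - b%:Z.
  have := divE Qinf; rewrite /place_multiple asboolT // asboolF; last exact: Qinf_neq_Ql.
  by case: ltP => h; lia.
have zl : - g%:Z <= valuation Ql z.
  have := divE Ql; rewrite /place_multiple asboolF; last by move/esym/Qinf_neq_Ql.
  by rewrite asboolT //; case: ltP => h; lia.
have zother P : P <> Qinf -> P <> Ql -> 0 <= valuation P z.
  move=> Pinf Pl; have := divE P; rewrite /place_multiple !asboolF //.
  by case: ltP => h; lia.
have z0 : z != 0.
  by apply/eqP => z0; have := val0 Qinf; rewrite -z0 zinf; lia.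
(* Multiplying by a power of [x - alpha_l] removes the pole at [Ql]; as
     [m > 0], the exponent [g] is large enough. *)
pose w := z * lin l ^+ g.
have w0 : w != 0 by rewrite mulf_neq0 ?expf_neq0.
have [xinf uinf sinf] := pole_values Qinf_pole.
have [xl ul sl] := zero_values Ql_zero.
have wl : m%:Z * g%:Z - g%:Z <= valuation Ql w.
  by rewrite valM ?expf_neq0 // valX // xl; lia.
have winf : valuation Qinf w = - b%:Z - m%:Z * g%:Z.
  rewrite valM ?expf_neq0 // valX // zinf val_poly_infinity ?polyXsubC_eq0 //.
  by rewrite size_XsubC xinf mul1r; ring.
have wint : integralOver emb w.
  apply: contrapT => /place_avoiding[P [xO /negP]]; apply.
  have dP := place_discrete P; rewrite vring_val //.
  have [->|Pl] := pselect (P = Ql); first by apply: le_trans wl; nia.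
  have Pinf : P <> Qinf.
    move=> e; case/idealP: Qinf_pole => _ [/eqP|]; first by rewrite invr_eq0 (negPf embX_neq0).
    by rewrite invrK -e xO.
  have [linO _] := other_places Pinf Pl.
  by rewrite valM ?expf_neq0 // valX // addr_ge0 ?zother ?mulr_ge0 // valuation_vring_ge0.
have [a [aR wE]] := span w.
have some : exists i, a i != 0.
  apply: contrapT => no; case/negP: w0; rewrite wE big1 // => k _.
  have [->|ak] := eqVneq (a k) 0; first by rewrite mul0r.
  by case: no; exists k.
have indep (a' : 'I_m -> F) : (forall k, rational (a' k)) -> \sum_(k < m) a' k * u ^+ k = 0 ->
    forall k, a' k = 0.
  move=> a'R S0 k; apply/eqP/negPn/negP => ak.
  by have [|/eqP] := sinf a' a'R; [exists k | case].
have [_ [i' [ai' Ei' _]]] := sinf a aR some.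
have [_ [il [_ El lmin]]] := sl a aR some.
have [|p [pE pmup]] := integral_term m_gt0 u_pow (aR i') (i := i').
  by apply: (component_integral m_gt0 m_neq0 u_pow indep) => //; rewrite -wE.
have p0 : p != 0 by apply: contraNneq ai' => p0; rewrite pE p0 rmorph0.
have degE : b%:Z + m%:Z * g%:Z = m%:Z * (size p).-1%:Z - i'%:Z * lambda0%:Z.
  have := winf; rewrite wE Ei' valM ?expf_neq0 // valX // uinf pE.
  by rewrite val_poly_infinity // xinf => h; lia.
have ii : i = i'.
  have : (m%:Z %| (i%:Z - i'%:Z))%Z.
    rewrite -(Gauss_dvdzl _ (m_coprime : coprimez m lambda0)).
    apply/dvdzP; exists (j1 + g%:Z - (size p).-1%:Z); rewrite mulrBl; lia.
  case/dvdzP=> q qE; have := ltn_ord i'.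
  by case: (ltgtP q 0) => q0; nia.
have j1E : j1 = (size p).-1%:Z - g%:Z.
  by apply: (mulfI (lt0r_neq0 mz0)); move: degE; rewrite -ii; lia.
have mupl : i%:Z + m%:Z * g%:Z - m%:Z * (mup (alpha l) p)%:Z <= g%:Z.
  have := lmin i' ai'; rewrite -El -wE [leRHS]valM ?expf_neq0 // valX // ul pE.
  rewrite (val_poly_zero Ql_zero) // -/(lin l) xl => h.
  by have := le_trans wl h; lia.
have ceil_mup k : ceil_div (i%:Z * (lambda k)%:Z) m <= (mup (alpha k) p)%:Z.
  rewrite ceil_div_le // -!PoszM lez_nat ii.
  by have := pmup (alpha k) p0; rewrite mup_curve.
have : partial_ceil i + (mup (alpha l) p)%:Z <= (size p).-1%:Z.
  have := sum_mup_le alpha_inj p0; rewrite (bigD1 l) //= -lez_nat PoszD.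
  apply: le_trans; rewrite addrC lerD2l.
  rewrite (_ : Posz _ = \sum_(k | k != l) (mup (alpha k) p)%:Z); last first.
    by rewrite (big_morph Posz PoszD (erefl _)).
  exact: ler_sum.
move: mupl j1E; nia.
Qed.

(** ** Gaps and their partners *)

Lemma weierstrass2_zero b :
  weierstrass_semigroup Qinf b <-> weierstrass_semigroup2 Qinf Ql (b, 0%N).
Proof.
have E : place_multiple b Qinf = place_multiple b Qinf \+ place_multiple 0 Ql :> divisor iota.
  by apply: funext => P /=; rewrite {3}/place_multiple; case: asboolP => _; rewrite addr0.
by split=> -[z zE]; exists z; rewrite zE /= -?E.
Qed.

(** The second entry is [0] when the extremal function is regular at [Ql]; then
    [b] is a pole order at [Qinf] alone. *)
Lemma semigroup_element (b i : nat) (j1 : int) :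
    b%:Z = m%:Z * j1 - i%:Z * lambda0%:Z ->
  weierstrass_semigroup2 Qinf Ql (b, absz (Num.max 0 (i%:Z + m%:Z * (partial_ceil i - j1)))).
Proof.
move=> bE; apply: (@extremal_pole_divisor i (partial_ceil i - j1)).
  by rewrite bE; ring.
by rewrite gez0_abs // le_max lexx.
Qed.

Lemma gap_partner_eq (b g i : nat) (j1 : int) :
    (0 < b)%N -> (i < m)%N -> b%:Z = m%:Z * j1 - i%:Z * lambda0%:Z ->
    g%:Z = i%:Z + m%:Z * (partial_ceil i - j1) ->
  gap_partner Qinf Ql b = g.
Proof.
move=> b0 im bE gE; have bg : weierstrass_semigroup2 Qinf Ql (b, g).
  by have := semigroup_element bE; rewrite -gE max_r.
have gmin k : weierstrass_semigroup2 Qinf Ql (b, k) -> (g <= k)%N.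
  by move=> /(second_pole_lower_bound b0 im bE); rewrite -gE lez_nat.
apply: xget_unique => [|k [bk kmin]]; first by split.
by apply/eqP; rewrite eqn_leq kmin // gmin.
Qed.

Lemma positive_partner_gap (b g i : nat) (j1 : int) :
    (0 < b)%N -> (i < m)%N -> b%:Z = m%:Z * j1 - i%:Z * lambda0%:Z ->
    g%:Z = i%:Z + m%:Z * (partial_ceil i - j1) -> (0 < g)%N ->
  gaps Qinf b.
Proof.
move=> b0 im bE gE g0 /weierstrass2_zero /(second_pole_lower_bound b0 im bE).
by rewrite -gE; lia.
Qed.

(** As [lambda0] is invertible modulo [m], every pole order at infinity occurs
    as that of a single term. *)
Lemma pole_order_residue (b : nat) : exists i j1,
  (i < m)%N /\ b%:Z = m%:Z * j1 - i%:Z * lambda0%:Z.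
Proof.
have /coprimezP[[c d] /= cd] : coprimez m lambda0 := m_coprime.
have m0 : m%:Z != 0 by rewrite eqz_nat -lt0n.
pose i := absz ((- (b%:Z * d)) %% m)%Z.
have iE : i%:Z = ((- (b%:Z * d)) %% m)%Z by rewrite gez0_abs // modz_ge0.
exists i, (b%:Z * c - ((- (b%:Z * d)) %/ m)%Z * lambda0%:Z); split.
  by rewrite -ltz_nat iE ltz_pmod.
rewrite iE; have := divz_eq (- (b%:Z * d)) m.
set q := (_ %/ _)%Z; set s := (_ %% _)%Z => E.
have -> : s = - (b%:Z * d) - q * m%:Z by rewrite E; ring.
rewrite -[LHS]mulr1 -cd; ring.
Qed.

Lemma partial_ceil0 : partial_ceil 0 = 0.
Proof.
rewrite /partial_ceil big1 // => k _; apply/eqP; rewrite eq_le.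
rewrite ceil_div_le // mul0r mulr0 lexx /=.
by have := ceil_div_ge (0%:Z * lambda k) m_gt0; rewrite mul0r pmulr_rge0.
Qed.

Lemma partial_ceilE (i : nat) : (0 < i < m)%N ->
  partial_ceil i = \sum_(k < r) ceil_div (i%:Z * (lambda k)%:Z) m - 1.
Proof.
case/andP=> i0 im; rewrite [in RHS](bigD1 l) //= lambda_l mulr1.
suff -> : ceil_div i m = 1 by rewrite addrAC subrr add0r.
apply/eqP; rewrite eq_le ceil_div_le // mulr1 lez_nat ltnW //=.
have := ceil_div_ge i%:Z m_gt0.
by case: (lerP 1 (ceil_div i m)) => // h; nia.
Qed.

Theorem generating_set_curve :
  minimal_generating_set Qinf Ql =
  [set s : nat * nat | exists i j1 j2 : int,
     [/\ 1 <= i <= m%:Z - 1,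
         ceil_div (i * lambda0%:Z) m <= j1,
         0 <= j2,
         j1 + j2 = \sum_(k < r) ceil_div (i * (lambda k)%:Z) m - 1
       & s.1%:Z = m%:Z * j1 - i * lambda0%:Z /\ s.2%:Z = i + m%:Z * j2]].
Proof.
apply/seteqP; split=> [_ [b bgap <-]|[b g] [i [j1 [j2 [i_bd j1_ge j2_ge jE /= [bE gE]]]]]].
  have [i [j1 [im bE]]] := pole_order_residue b.
  set g := i%:Z + m%:Z * (partial_ceil i - j1).
  have g_gt0 : 0 < g.
    rewrite ltNge; apply/negP => g_le0; apply: bgap; apply/weierstrass2_zero.
    by have := semigroup_element bE; rewrite -/g max_l.
  have i0 : (0 < i)%N.
    rewrite lt0n; apply/eqP => i0; move: g_gt0 bE.
    by rewrite /g i0 partial_ceil0; lia.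
  have b0 : (0 < b)%N.
    rewrite lt0n; apply/eqP => b0.
    have : (m %| i)%N.
      rewrite -(Gauss_dvdl _ m_coprime) -[(m %| _)%N]/(m%:Z %| (i * lambda0)%N%:Z)%Z.
      by apply/dvdzP; exists j1; move: bE; rewrite b0 PoszM; lia.
    by move/(dvdn_leq i0); rewrite leqNgt im.
  have gN : (absz g)%:Z = g by rewrite gez0_abs // ltW.
  have -> := gap_partner_eq b0 im bE gN.
  exists i, j1, (partial_ceil i - j1); split=> /=.
  - by move: i0 im; lia.
  - by rewrite ceil_div_le //; move: bE; lia.
  - by move: g_gt0 im; rewrite /g; nia.
  - by rewrite -partial_ceilE ?i0 //; ring.
  - by rewrite gN.
case: i i_bd j1_ge jE bE gE => // i i_bd j1_ge jE bE gE.
have im : (0 < i < m)%N by move: i_bd; lia.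
have {}jE : j2 = partial_ceil i - j1 by rewrite partial_ceilE // -jE; ring.
rewrite jE in gE; have [i0 ilt] := andP im.
have b0 : (0 < b)%N.
  rewrite lt0n; apply/eqP => b0.
  have : (m %| i)%N.
    rewrite -(Gauss_dvdl _ m_coprime) -[(m %| _)%N]/(m%:Z %| (i * lambda0)%N%:Z)%Z.
    by apply/dvdzP; exists j1; move: bE; rewrite b0 PoszM; lia.
  by move/(dvdn_leq i0); rewrite leqNgt ilt.
have g0 : (0 < g)%N by move: gE j2_ge; rewrite jE; nia.
exists b; first exact: positive_partner_gap b0 ilt bE gE g0.
by rewrite (gap_partner_eq b0 ilt bE gE).
Qed.

End Curve.

End FunctionField.

(** * The function field of the curve *)

Section Instance.
Variables (K : closedFieldType) (L : fieldExtType {fraction {poly K}}).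

Definition poly_in_ext : {rmorphism {poly K} -> L} :=
  in_alg L \o @FracField.tofrac {poly K}.

Lemma poly_in_extC c : poly_in_ext c%:P = ext_const L c.
Proof. by []. Qed.

Lemma poly_in_ext_inj : injective poly_in_ext.
Proof.
move=> p q /(fmorph_inj (in_alg L)) /eqP; rewrite tofrac_eq => /eqP; exact.
Qed.

Lemma rational_in_alg (a : {fraction {poly K}}) : rational poly_in_ext a%:A.
Proof.
have [p [q [q0 ->]]] := fraction_quotient a; exists p, q; split; first exact: q0.
exact: (fmorph_div (in_alg L)).
Qed.

Lemma minPoly_bound (z : L) : exists q : {poly L},
  [/\ q != 0, (size q <= (\dim {:L}).+1)%N, root q z
    & forall i, rational poly_in_ext q`_i].
Proof.
exists (minPoly 1 z); split.
- exact/monic_neq0/monic_minPoly.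
- rewrite size_minPoly ltnS; have := dim_Fadjoin 1%AS z.
  by rewrite dimv1 muln1 => <-; apply/dimvS/subvf.
- exact: root_minPoly.
- move=> i; have /vlineP[a ->] := (polyOverP (minPolyOver 1%AS z)) i.
  exact: rational_in_alg.
Qed.

Lemma generator_span (y : L) (f : {poly K}) m : (0 < m)%N ->
    <<1%VS; y>>%VS = fullv -> y^-1 ^+ m * poly_in_ext f = 1 ->
  forall z : L, exists a : 'I_m -> L,
    (forall i, rational poly_in_ext (a i)) /\ z = \sum_i a i * y^-1 ^+ i.
Proof.
move=> m0 yL upow z.
have uL : <<1%VS; y^-1>>%VS = fullv.
  apply/eqP; rewrite eqEsubv subvf -yL; apply/FadjoinP; split; first exact: sub1v.
  by rewrite -[X in X \in _]invrK memvV memv_adjoin.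
have : z \in <<1%VS; y^-1>>%VS by rewrite uL memvf.
case/Fadjoin1_polyP => p ->.
pose S : subringClosed L := HB.pack (fun a => `[< rational poly_in_ext a >] : bool)
  (GRing.isSubringClosed.Build L _ (rational_subring poly_in_ext_inj)).
have inS w : (w \in S) = `[< rational poly_in_ext w >] by [].
have [||r [rS rE]] := @fold_powers _ m y^-1 m0 S (map_poly (in_alg L) p).
- by rewrite inS; apply/asboolP; exact: (u_pow_rational poly_in_ext_inj upow).
- by apply/polyOverP => i; rewrite coef_map inS; apply/asboolP/rational_in_alg.
exists r; split=> [i|]; first by apply/asboolP; rewrite -inS.
by have := rE 1 (expr1n _ _); rewrite mul1r.
Qed.

End Instance.

Theorem proposition4p5
  (* K is the algebraic closure of a finite field of characteristic p *)
  (p : nat) (Fq : finFieldType) (hp : p \in [pchar Fq])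
  (K : closedFieldType) (j : {rmorphism Fq -> K})
  (hK : forall c : K, algebraicOver j c)
  (r : nat) (alpha : 'I_r -> K) (halpha : injective alpha)
  (m : nat) (hm : (0 < m)%N) (hpm : ~~ (p %| m)%N)
  (lambda : 'I_r -> nat) (hlambda : forall k, (1 <= lambda k < m)%N)
  (lambda0 : nat) (hlambda0 : lambda0 = (\sum_(k < r) lambda k)%N)
  (hcop : gcdn m lambda0 = 1%N)
  (* L = K(x, y), as an extension of the rational function field K(x) *)
  (L : fieldExtType {fraction {poly K}}) (x y : L)
  (hx : x = (ratfun_X K)%:A)
  (hy : y ^+ m = \prod_(k < r) (x - ext_const L (alpha k)) ^+ lambda k)
  (hL : <<1%VS; y>>%VS = fullv)
  (* Qinf lies over the pole of x, Ql over the zero of x - alpha_l *)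
  (Pinf : place (ratfun_const K)) (hPinf : is_pole Pinf (ratfun_X K))
  (Qinf : place (ext_const L)) (hQinf : lies_over Qinf Pinf)
  (l : 'I_r) (hl : lambda l = 1%N)
  (Pl : place (ratfun_const K))
  (hPl : is_zero Pl (ratfun_X K - ratfun_const K (alpha l)))
  (Ql : place (ext_const L)) (hQl : lies_over Ql Pl) :
  minimal_generating_set Qinf Ql =
  [set s : nat * nat | exists i j1 j2 : int,
     [/\ 1 <= i <= m%:Z - 1,
         ceil_div (i * lambda0%:Z) m <= j1,
         0 <= j2,
         j1 + j2 = \sum_(k < r) ceil_div (i * (lambda k)%:Z) m - 1
       & s.1%:Z = m%:Z * j1 - i * lambda0%:Z /\ s.2%:Z = i + m%:Z * j2]].
Proof.
have m_neq0 : m%:R != 0 :> K.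
  have hpK : p \in [pchar K] by rewrite -(fmorph_pchar j) in hp *.
  by rewrite -(dvdn_pcharf hpK).
pose f : {poly K} := \prod_k ('X - (alpha k)%:P) ^+ lambda k.
have linE (c : K) : poly_in_ext L ('X - c%:P) = x - ext_const L c.
  by rewrite rmorphB hx.
have yf : y ^+ m = poly_in_ext L f.
  by rewrite hy rmorph_prod; apply: eq_bigr => k _; rewrite rmorphXn linE.
have f0 : f != 0.
  by apply/prodf_neq0 => k _; rewrite expf_neq0 // polyXsubC_eq0.
have upow : y^-1 ^+ m * poly_in_ext L f = 1.
  rewrite exprVn yf mulVf //; apply: contra f0 => /eqP h.
  by apply/eqP/(@poly_in_ext_inj K L); rewrite h rmorph0.
have Qinf_pole : (poly_in_ext L 'X)^-1 \in place_ideal Qinf.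
  have := hQinf _ (valuation_lt0_ideal hPinf).
  by rewrite -[_%:A]/(in_alg L _) fmorphV.
have Ql_zero : poly_in_ext L ('X - (alpha l)%:P) \in place_ideal Ql.
  have := hQl _ (valuation_gt0_ideal hPl).
  by rewrite /ratfun_X /= -rmorphB.
exact: (generating_set_curve (@poly_in_extC K L) (@poly_in_ext_inj K L) (@minPoly_bound K L)
  halpha hm m_neq0 hl hlambda0 (introT eqP hcop) (erefl f) upow
  (generator_span hm hL upow) Qinf_pole Ql_zero).
Qed.
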